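(* Fix a real number $k>-1$ and positive integers $m,n$ with $\gcd(m,n)=1$. Then \[ \int_1^\infty \frac{\pi_k(t;m,n)-\pi(t^{k+1};m,n)}{t^{k+2}}\,dt \;=\; -\frac{\log(k+1)}{(k+1)\,\varphi(m)}, \] where the improper integral is understood as $\lim_{x\to\infty}\int_1^x$. In particular this value is negative when $k>0$ and positive when $-1<k<0$.
   Context: Throughout, $p$ denotes a prime. For real $x$ and real $k$, and coprime positive integers $m,n$, define $\pi(x;m,n)=\#\{p\le x : p\equiv n \pmod m\}$ and $\pi_k(x;m,n)=\sum_{p\le x,\ p\equiv n \pmod m} p^k$. $\varphi$ denotes Euler's totient function. *)

(* Defs.v *)
From Stdlib Require Import Reals List Arith.
From Coquelicot Require Import Coquelicot.
From mathcomp Require prime.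
Import ListNotations.
Open Scope R_scope.

Definition prime_in_class (m n p : nat) : bool :=
  (mathcomp.boot.prime.prime p && Nat.eqb (p mod m) (n mod m))%bool.

(* \sum_{p <= x, p prime, p = n mod m} w p.  Every integer p <= x satisfies
   p < up x, so ranging over seq 0 (Z.to_nat (up x)) covers all of them. *)
Definition prime_class_sum (w : nat -> R) (x : R) (m n : nat) : R :=
  fold_right Rplus 0
    (map (fun p => if prime_in_class m n p
                   then (if Rle_dec (INR p) x then w p else 0) else 0)
         (seq 0 (Z.to_nat (up x)))).

Definition prime_pi (x : R) (m n : nat) : R := prime_class_sum (fun _ => 1) x m n.

(* pi_k(x; m, n) = \sum_{p <= x, p = n mod m} p^k  (p >= 2 so Rpower is the real power) *)
Definition prime_pi_k (k x : R) (m n : nat) : R :=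
  prime_class_sum (fun p => Rpower (INR p) k) x m n.

Definition phi (m : nat) : nat := mathcomp.boot.prime.totient m.

(* Main.v *)
(** Integrating over each prime separately and substituting [u = t^(k+1)] turns
    the integral up to [x] into [1/(k+1)] times
    [S(x) - S(x^(k+1)) - pi_k(x)/x^(k+1) + pi(x^(k+1))/x^(k+1)], where [S(x)] is
    the sum of [1/p] over the primes [p <= x], [p = n mod m].  Mertens' theorem
    [S(x) = log log x / phi(m) + M + o(1)] makes [S(x) - S(x^(k+1))] tend to
    [-log(k+1)/phi(m)].  It also kills the last two terms: they have the form
    [sum (1/p)(p/x)^c] with [c > 0], where the primes below [x^(1-eps)] contribute
    [O(x^(-c eps) S(x))] and the others at most
    [S(x) - S(x^(1-eps))], about [-log(1-eps)/phi(m)].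

    Mertens' theorem in the class [n mod m] is obtained by partial summation from
    [sum Lambda(d)/d = log N / phi(m) + O(1)], proved as by Shapiro: for a
    nonprincipal character [chi] the sum [D = sum chi(d) Lambda(d)/d] is [O(1)] if
    [L(1,chi) <> 0] and [- log N + O(1)] otherwise.  Since the [D]'s of all
    characters add up to a nonnegative number, at most one [L(1,chi)] vanishes, so
    [chi] is then real; this case is excluded by Monsky's argument: the Lambert
    series [sum chi(n) t^n/(1-t^n)] would stay bounded as [t -> 1], although its
    power series coefficients are nonnegative and at least [1] at squares. *)

From Pilot Require Import Defs.
From mathcomp Require all_boot all_order all_algebra all_fingroup all_solvable.
From mathcomp Require all_field all_character complex Rstruct ring lra zify.
From Stdlib Require Reals List ZArith.

(* The imports are confined to a module because the MathComp notations would
   change the meaning of [(0 < m)%nat] in the theorem. *)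
Module Mertens.

Import all_boot all_order all_algebra all_fingroup all_solvable all_field.
Import all_character complex Rstruct ring lra zify.
Import Order.TTheory GRing.Theory Num.Theory Normc.
Set Implicit Arguments.
Unset Strict Implicit.
Unset Printing Implicit Defensive.
Local Open Scope ring_scope.
Local Open Scope complex_scope.
Local Notation R := Rdefinitions.R.

(** * Arithmetic functions and Chebyshev bounds *)

(** Every estimate is kept finite: sums up to [N] with explicit errors, so that no Dirichlet series
    or power series is ever summed, and L(1,chi) enters only as the limit of its partial sums,
    approached at rate O(1/N). That rate drives Shapiro's argument. In a convolution sum the factor
    at [d] is a partial sum up to [N/d]; its error O(d/N) cancels the weight [1/d], and what is left
    is a mean of the coefficients, bounded through Chebyshev's psi(N) = O(N) in one case and through
    Stirling's formula in the other. The Lambert series stays bounded because its weight t^n/(1-t^n)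
    falls short of 1/(n(1-t)) by a nonnegative sequence that decreases in [n] and starts at 1. If
    L(1,chi) = 0, the part with weights 1/(n(1-t)) disappears in the limit, and Abel summation
    bounds the rest by [2 * m] for every [t]. *)

Definition lg (n : nat) : R := Rpower.ln n%:R.

Lemma ln_le_sub1 (u : R) : 0 < u -> Rpower.ln u <= u - 1.
Proof.
move=> u0; have /RleP h := Rpower.exp_ineq1_le (Rpower.ln u).
by move: h; rewrite Rpower.exp_ln; [rewrite RplusE R1E; lra | apply/RltP].
Qed.

Lemma lnV_lb (u : R) : 0 < u -> 1 - u^-1 <= Rpower.ln u.
Proof.
move=> u0; have := ln_le_sub1 (u := u^-1); rewrite invr_gt0 u0 => /(_ isT).
by rewrite -RinvE Rpower.ln_Rinv ?RoppE; [lra | apply/RltP].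
Qed.

Lemma lnM (u v : R) : 0 < u -> 0 < v ->
  Rpower.ln (u * v) = Rpower.ln u + Rpower.ln v.
Proof. by move=> u0 v0; rewrite -RmultE Rpower.ln_mult //; apply/RltP. Qed.

Lemma ln_div (u v : R) : 0 < u -> 0 < v ->
  Rpower.ln (u / v) = Rpower.ln u - Rpower.ln v.
Proof.
move=> u0 v0; have vi : 0 < v^-1 by rewrite invr_gt0.
by rewrite lnM // -RinvE Rpower.ln_Rinv //; apply/RltP.
Qed.

Lemma lg1 : lg 1 = 0.
Proof. by rewrite /lg Rpower.ln_1. Qed.

Lemma lgM a b : (0 < a)%N -> (0 < b)%N -> lg (a * b)%N = lg a + lg b.
Proof. by move=> a0 b0; rewrite /lg natrM lnM ?ltr0n. Qed.

Lemma lg_le a b : (0 < a)%N -> (a <= b)%N -> lg a <= lg b.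
Proof.
move=> a0; rewrite leq_eqVlt => /orP[/eqP->//|ab]; apply/ltW/RltP.
by apply: Rpower.ln_increasing; apply/RltP; rewrite ?ltr0n ?ltr_nat.
Qed.

(** At [a = 0] this rests on the default value of Stdlib's [ln], which is 0 off the positive
    reals. *)
Lemma lg_ge0 a : 0 <= lg a.
Proof.
case: a => [|a]; last by rewrite -lg1 lg_le.
rewrite /lg /Rpower.ln; case: RIneq.Rlt_dec => //= h.
by move/RltP: (h); rewrite ltxx.
Qed.

Lemma lgS_ub n : (0 < n)%N -> lg n.+1 - lg n <= n%:R^-1.
Proof.
move=> n0; have nr : 0 < n%:R :> R by rewrite ltr0n.
rewrite /lg -ln_div ?ltr0n //.
apply: le_trans (ln_le_sub1 _) _; first by rewrite divr_gt0 ?ltr0n.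
by rewrite -natr1 mulrDl divff ?gt_eqF //; lra.
Qed.

Lemma lgS_lb n : (0 < n)%N -> n.+1%:R^-1 <= lg n.+1 - lg n.
Proof.
move=> n0; have nr : 0 < n%:R :> R by rewrite ltr0n.
have nr1 : 0 < n.+1%:R :> R by rewrite ltr0n.
rewrite /lg -ln_div //; apply: le_trans (lnV_lb _); last by rewrite divr_gt0.
rewrite invf_div -[X in X - _](divff (x := n.+1%:R)) ?gt_eqF // -mulrBl -natrB //.
by rewrite subSnn mul1r.
Qed.

Lemma lg_le_id n : lg n <= n%:R.
Proof.
case: n => [|n]; first by rewrite /lg /Rpower.ln; case: RIneq.Rlt_dec => //= h;
  move/RltP: (h); rewrite ltxx.
by apply: le_trans (ln_le_sub1 _) _; rewrite ?ltr0n //; lra.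
Qed.

Lemma lg3_ge1 : 1 <= lg 3.
Proof.
rewrite leNgt; apply/negP => /RltP /Rpower.exp_increasing.
rewrite /lg Rpower.exp_ln; last by apply/RltP.
move=> h; have := RIneq.Rlt_le_trans _ _ _ h Rpower.exp_le_3.
by rewrite IZRposE INRE => /RltP; rewrite ltxx.
Qed.

(** Stirling's formula up to O(N): in the induction, [n * (lg n.+1 - lg n)] lies between 0 and 1. *)
Lemma sum_lg_bounds N :
  N%:R * lg N - N%:R <= \sum_(1 <= n < N.+1) lg n <= N%:R * lg N.
Proof.
elim: N => [|N /andP[IH1 IH2]]; first by rewrite big_geq // !mul0r subr0 lexx.
rewrite big_nat_recr //=; case: N IH1 IH2 => [|N] IH1 IH2.
  by rewrite big_geq // lg1 !mul1r; lra.
have h1 := lgS_ub (n := N.+1) isT; have h2 := lgS_lb (n := N.+1) isT.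
have n0 : 0 < N.+1%:R :> R by rewrite ltr0n.
have h3 : N.+1%:R * (lg N.+2 - lg N.+1) <= 1.
  by apply: le_trans (_ : N.+1%:R * N.+1%:R^-1 <= _); rewrite ?ler_pM2l // divff ?gt_eqF.
have h4 : 0 <= N.+1%:R * (lg N.+2 - lg N.+1).
  by apply: mulr_ge0; [exact: ltW | apply: le_trans h2; rewrite invr_ge0].
move: IH1 IH2 h3 h4; rewrite -[N.+2]addn1 natrD !mulrDl !mul1r.
set a := lg _; set b := lg (_ + _); set c := \sum_(_ <= _ < _) _; lra.
Qed.

Lemma sum_multiples (V : nmodType) (G : nat -> V) d N : (0 < d)%N ->
  \sum_(1 <= n < N.+1 | (d %| n)%N) G n = \sum_(1 <= q < (N %/ d).+1) G (d * q)%N.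
Proof.
move=> d0; elim: N => [|N IH]; first by rewrite div0n !big_geq.
rewrite big_mkcond big_nat_recr //= -big_mkcond IH divnS //.
case: ifP => /= h; last by rewrite addr0 add0n.
rewrite add1n [RHS]big_nat_recr //=; congr (_ + G _).
have := divnS N d0; rewrite h add1n => <-.
by rewrite mulnC divnK.
Qed.

Lemma dsum_widen (V : nmodType) (F : nat -> V) n N : (0 < n <= N)%N ->
  \sum_(1 <= d < N.+1 | (d %| n)%N) F d = \sum_(1 <= d < n.+1 | (d %| n)%N) F d.
Proof.
move=> /andP[n0 nN]; rewrite (big_cat_nat (n := n.+1)) //= [X in _ + X]big1_seq ?addr0 //.
move=> d; rewrite mem_index_iota => /andP[dn /andP[lt _]].
by have := dvdn_leq n0 dn; rewrite leqNgt lt.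
Qed.

(** Sums over the pairs with [d * q <= N], grouped by their product on one side and by [d] on the
    other. All convolution identities below come from it. *)
Lemma dirichlet_sum (V : nmodType) (F : nat -> nat -> V) N :
  \sum_(1 <= n < N.+1) \sum_(1 <= d < n.+1 | (d %| n)%N) F d (n %/ d)%N
  = \sum_(1 <= d < N.+1) \sum_(1 <= q < (N %/ d).+1) F d q.
Proof.
transitivity (\sum_(1 <= n < N.+1) \sum_(1 <= d < N.+1 | (d %| n)%N) F d (n %/ d)%N).
  by apply: eq_big_nat => n nN; rewrite [RHS]dsum_widen.
rewrite (exchange_big_dep_nat xpredT) //=.
apply: eq_big_nat => d /andP[d0 dN].
rewrite (sum_multiples (fun n => F d (n %/ d)%N)) //.
by apply: eq_bigr => q _; rewrite mulKn.
Qed.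

(** A divisor of [p * n] is either [p * d] with [d] dividing [n], or prime to [p] and then a divisor
    of [n]. This is the induction step for all divisor sums: one prime factor is removed at a
    time. *)
Lemma dsum_prime (V : nmodType) (F : nat -> V) p n : prime p -> (0 < n)%N ->
  \sum_(1 <= d < (p * n).+1 | (d %| p * n)%N) F d =
  \sum_(1 <= d < n.+1 | (d %| n)%N) (F (p * d)%N + (if (p %| d)%N then 0 else F d)).
Proof.
move=> pp n0; have p0 := prime_gt0 pp.
rewrite (bigID (fun d => (p %| d)%N)) /= big_split /=; congr (_ + _).
  under eq_bigl do rewrite andbC.
  rewrite big_mkcondr sum_multiples //.
  rewrite mulKn // big_mkcond [RHS]big_mkcond; apply: eq_bigr => d _.
  by rewrite dvdn_pmul2l.
rewrite -(@dsum_widen _ _ _ (p * n)%N); last by rewrite n0 leq_pmull.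
rewrite big_mkcond [RHS]big_mkcond /=; apply: eq_bigr => d _.
case: (boolP (p %| d)%N) => pd; first by rewrite andbF; case: ifP.
by rewrite andbT Gauss_dvdr // coprime_sym prime_coprime.
Qed.

(** * The Moebius and von Mangoldt functions, and Chebyshev's bound *)

Definition moebius (n : nat) : R :=
  \prod_(p <- primes n) (if logn p n == 1%N then -1 else 0).

(** The list [primes n] of distinct prime divisors is a singleton exactly when [n] is a power of a
    prime with positive exponent. *)
Definition mangoldt (n : nat) : R := if primes n is [:: p] then lg p else 0.

Lemma moebius_bound n : `|moebius n| <= 1.
Proof.
rewrite /moebius; elim/big_rec: _ => [|p x _ xb]; first by rewrite normr1.
by case: ifP => _; rewrite ?mulN1r ?normrN ?mul0r ?normr0.
Qed.

Lemma moebius_primeM p e : prime p -> (0 < e)%N ->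
  moebius (p * e) = if (p %| e)%N then 0 else - moebius e.
Proof.
move=> pp e0; have p0 := prime_gt0 pp.
have pin : p \in primes (p * e) by rewrite mem_primes pp muln_gt0 p0 e0 dvdn_mulr.
rewrite /moebius; case: ifP => pe.
  rewrite (bigD1_seq p) ?primes_uniq //= lognM // logn_prime // eqxx.
  have : (0 < logn p e)%N by rewrite logn_gt0 mem_primes pp e0.
  by case: (logn p e) => // k _; rewrite mul0r.
have pr : perm_eq (primes (p * e)) (p :: primes e).
  apply: uniq_perm; rewrite ?primes_uniq //= ?primes_uniq ?andbT ?mem_primes ?pe ?andbF //.
  by move=> q; rewrite primesM // primes_prime // inE.
rewrite (perm_big _ pr) big_cons lognM // logn_prime // eqxx.
have -> : logn p e = 0%N by apply/eqP; rewrite -leqn0 leqNgt logn_gt0 mem_primes pe !andbF.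
rewrite /= mulN1r; congr (- _); rewrite big_seq [RHS]big_seq; apply: eq_bigr => q.
rewrite mem_primes => /and3P[qp _ qe]; rewrite lognM // logn_prime //.
by have [qp'|//] := eqVneq q p; rewrite qp' pe in qe.
Qed.

(** For a prime [p] dividing [n], the terms at [p * d] and at [d] cancel when [p] does not divide
    [d]; the remaining terms are 0. *)
Lemma sum_moebius n : (0 < n)%N ->
  \sum_(1 <= d < n.+1 | (d %| n)%N) moebius d = (n == 1%N)%:R.
Proof.
move=> n0; have [->|n1] := eqVneq n 1%N.
  by rewrite big_mkcond big_nat1 /= /moebius big_nil.
have n2 : (1 < n)%N by rewrite ltn_neqAle eq_sym n1.
have pp := pdiv_prime n2; have := divnK (pdiv_dvd n); rewrite mulnC.
set p := pdiv n in pp *; set m := (n %/ p)%N => nE.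
have m0 : (0 < m)%N by move: n0; rewrite -nE muln_gt0 => /andP[].
rewrite -nE dsum_prime // big_seq_cond big1 // => d.
rewrite mem_index_iota => /andP[/andP[d0 _] _].
by rewrite moebius_primeM //; case: ifP; rewrite ?addr0 ?addNr.
Qed.

Lemma mangoldt_ge0 n : 0 <= mangoldt n.
Proof. by rewrite /mangoldt; case: (primes n) => [|p []] //; exact: lg_ge0. Qed.

Lemma mangoldt1 : mangoldt 1 = 0.
Proof. by []. Qed.

Lemma mangoldt_prime p : prime p -> mangoldt p = lg p.
Proof. by move=> pp; rewrite /mangoldt primes_prime. Qed.

Lemma mangoldt_primeM p e : prime p -> (0 < e)%N ->
  mangoldt (p * e) =
    if (p %| e)%N then mangoldt e else if e == 1%N then lg p else 0.
Proof.
move=> pp e0; have p0 := prime_gt0 pp.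
case: ifP => pe.
  rewrite /mangoldt; congr (if _ is [:: q] then lg q else 0).
  apply/eq_primes => q; rewrite primesM // primes_prime // inE.
  by case: eqP => //= ->; rewrite mem_primes pp e0 pe.
case: eqP => [->|/eqP e1]; first by rewrite muln1 mangoldt_prime.
have pin : p \in primes (p * e) by rewrite mem_primes pp muln_gt0 p0 e0 dvdn_mulr.
have e2 : (1 < e)%N by rewrite ltn_neqAle eq_sym e1.
have qin : pdiv e \in primes (p * e).
  by rewrite mem_primes pdiv_prime // muln_gt0 p0 e0 dvdn_mull // pdiv_dvd.
move: pin qin; rewrite /mangoldt; case: (primes _) => [|a [|b s]] //.
rewrite !inE => /eqP pa /eqP qa.
by move: pe; rewrite pa -qa pdiv_dvd.
Qed.

(** Passing from [m] to [p * m] changes the divisor sum only through the divisor [p * 1], or its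
    analogue at higher powers of [p]: in the pairing of [dsum_prime] all surplus is the single term
    [lg p] at [d = 1]. *)
Lemma sum_mangoldt n : (0 < n)%N ->
  \sum_(1 <= d < n.+1 | (d %| n)%N) mangoldt d = lg n.
Proof.
elim/ltn_ind: n => n IH n0; have [->|n1] := eqVneq n 1%N.
  by rewrite big_mkcond big_nat1 /= mangoldt1 lg1.
have n2 : (1 < n)%N by rewrite ltn_neqAle eq_sym n1.
have pp := pdiv_prime n2; have := divnK (pdiv_dvd n); rewrite mulnC.
set p := pdiv n in pp *; set m := (n %/ p)%N => nE.
have m0 : (0 < m)%N by move: n0; rewrite -nE muln_gt0 => /andP[].
have mn : (m < n)%N by rewrite -nE ltn_Pmull // prime_gt1.
rewrite -nE lgM ?(prime_gt0 pp) // -(IH _ mn m0) dsum_prime //.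
have -> : lg p = \sum_(1 <= d < m.+1 | (d %| m)%N) (if d == 1%N then lg p else 0).
  rewrite big_mkcond big_ltn //= dvd1n ?eqxx big1_seq /= ?addr0 // => d.
  rewrite mem_index_iota => /andP[d1 _].
  by rewrite gtn_eqF //; case: ifP.
rewrite -big_split /= big_seq_cond [RHS]big_seq_cond; apply: eq_bigr => d.
rewrite mem_index_iota => /andP[/andP[d0 _] _].
rewrite mangoldt_primeM //; case: ifP => pd; last by [].
rewrite addr0; case: eqP => [d1|_]; last by rewrite add0r.
by move: pd; rewrite d1 dvdn1 => /eqP p1; rewrite p1 in pp.
Qed.

Definition psi (N : nat) : R := \sum_(1 <= d < N.+1) mangoldt d.

Lemma sum_lg_mangoldt N :
  \sum_(1 <= n < N.+1) lg n = \sum_(1 <= d < N.+1) mangoldt d * (N %/ d)%:R.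
Proof.
transitivity (\sum_(1 <= n < N.+1) \sum_(1 <= d < n.+1 | (d %| n)%N)
    (fun d q : nat => mangoldt d) d (n %/ d)%N).
  by apply: eq_big_nat => n /andP[n0 _]; rewrite -sum_mangoldt.
rewrite (dirichlet_sum (fun d q : nat => mangoldt d)); apply: eq_bigr => d _.
by rewrite sumr_const_nat subn1 /= mulr_natr.
Qed.

(** Chebyshev's device: on the right, the coefficient [N %/ d - 2 * (N %/ 2 %/ d)] of [mangoldt d]
    is never negative, and it is at least 1 when [N %/ 2 < d <= N]. *)
Lemma psi_half N : psi N - psi (N %/ 2) <=
  \sum_(1 <= n < N.+1) lg n - 2 * \sum_(1 <= n < (N %/ 2).+1) lg n.
Proof.
have le2 : ((N %/ 2).+1 <= N.+1)%N by rewrite ltnS leq_div.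
rewrite !sum_lg_mangoldt mulr_sumr /psi.
have -> : \sum_(1 <= d < (N %/ 2).+1) 2 * (mangoldt d * (N %/ 2 %/ d)%:R) =
  \sum_(1 <= d < N.+1) 2 * (mangoldt d * (N %/ 2 %/ d)%:R) :> R.
  rewrite [RHS](big_cat_nat (n := (N %/ 2).+1)) //= [X in _ = _ + X]big1_seq ?addr0 //.
  move=> d; rewrite mem_index_iota => /andP[_ /andP[lt _]].
  by rewrite divn_small // !mulr0.
rewrite (big_cat_nat (n := (N %/ 2).+1) (p := N.+1)) //= addrAC subrr add0r -sumrB.
rewrite [leRHS](big_cat_nat (n := (N %/ 2).+1)) //=.
have h2 d : ((N %/ 2 %/ d).*2 <= N %/ d)%N.
  by rewrite divnAC -muln2 leq_divM.
rewrite -[leLHS]add0r; apply: lerD.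
  apply: sumr_ge0 => d _; rewrite mulrCA -mulrBr; apply: mulr_ge0; first exact: mangoldt_ge0.
  by rewrite subr_ge0 -natrM ler_nat mul2n.
rewrite big_seq [leRHS]big_seq; apply: ler_sum => d.
rewrite mem_index_iota => /andP[d1 d2].
rewrite [in X in _ - X]divn_small // !mulr0 subr0 -[leLHS]mulr1.
apply: ler_wpM2l; first exact: mangoldt_ge0.
by rewrite ler1n divn_gt0 // (leq_trans _ d1).
Qed.

Lemma psi_bound N : psi N <= 8 * N%:R.
Proof.
elim/ltn_ind: N => N IH; have [->|N0] := posnP N; first by rewrite /psi big_geq // mulr0.
have [N1|N1] := leqP N 1.
  have -> : N = 1%N by apply/eqP; rewrite eqn_leq N1.
  by rewrite /psi big_nat1 mangoldt1; lra.
have hN : (N %/ 2 < N)%N by rewrite ltn_Pdiv.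
have := IH _ hN; have := psi_half N; set h := (N %/ 2)%N in hN *.
have h0 : (0 < h)%N by rewrite divn_gt0.
have /andP[_ b1] := sum_lg_bounds N; have /andP[b2 _] := sum_lg_bounds h.
have hle : (h * 2 <= N)%N := leq_divM N 2.
have hge : (N <= h * 2 + 1)%N by rewrite /h; lia.
(* Since [N <= 2 * h + 1 <= 3 * h], the bounds on the sums of [lg] make the right side of [psi_half]
   at most [2 * N + 3 * h], hence at most [7/2 * N]. The induction hypothesis adds [8 * h <= 4 * N],
   and the total stays below [8 * N]. *)
have b3 : lg N <= lg 3 + lg h.
  by rewrite -lgM //; apply: lg_le => //; lia.
have b4 : lg 3 <= 2.
  by apply: le_trans (ln_le_sub1 _) _; rewrite ?ltr0n //; lra.
have b5 : lg h <= h%:R := lg_le_id h.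
have b6 : 0 <= lg h := lg_ge0 h.
have b7 : N%:R <= h%:R * 2 + 1 :> R by move: hge; rewrite -(ler_nat R) natrD natrM.
have b8 : h%:R * 2 <= N%:R :> R by move: hle; rewrite -(ler_nat R) natrM.
have n0 : 0 <= N%:R :> R by [].
have c1 : N%:R * lg N <= N%:R * (2 + lg h) by apply: ler_wpM2l => //; lra.
have c2 : N%:R * lg h <= (h%:R * 2 + 1) * lg h by apply: ler_wpM2r.
move: b1 b2 c1 c2; rewrite !mulrDl !mulrDr; set a := \sum_(_ <= _ < _) _.
set b := \sum_(_ <= _ < _) _; nra.
Qed.

(** Replacing [N %/ d] by [N / d] in [sum_lg_mangoldt] changes the sum by at most [psi N <= 8 * N];
    division by [N] leaves the constant 8. *)
Lemma sum_mangoldt_div N : (0 < N)%N ->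
  `|\sum_(1 <= d < N.+1) mangoldt d / d%:R - lg N| <= 8.
Proof.
move=> N0; have n0 : 0 < N%:R :> R by rewrite ltr0n.
have /andP[b1 b2] := sum_lg_bounds N; have b3 := psi_bound N.
suff [c1 c2] : N%:R * (\sum_(1 <= d < N.+1) mangoldt d / d%:R) - psi N
      <= \sum_(1 <= n < N.+1) lg n /\
    \sum_(1 <= n < N.+1) lg n <= N%:R * \sum_(1 <= d < N.+1) mangoldt d / d%:R.
  rewrite ler_norml; apply/andP; split; rewrite -(ler_pM2l n0) mulrBr; lra.
rewrite sum_lg_mangoldt mulr_sumr -sumrB.
have key d : (0 < d)%N -> (N %/ d)%:R <= N%:R / d%:R :> R /\ N%:R / d%:R <= (N %/ d)%:R + 1 :> R.
  move=> d0; have dr : 0 < d%:R :> R by rewrite ltr0n.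
  rewrite ler_pdivlMr // ler_pdivrMr // natr1 -!natrM !ler_nat.
  by rewrite leq_divM ltnW // ltn_ceil.
split; rewrite big_seq [leRHS]big_seq; apply: ler_sum => d; rewrite mem_index_iota => /andP[d0 _];
  have [k1 k2] := key d d0; have l0 := mangoldt_ge0 d; rewrite mulrCA.
  by rewrite -{2}[mangoldt d]mulr1 -mulrBr; apply: ler_wpM2l => //; lra.
exact: ler_wpM2l.
Qed.

(** Moebius inversion of [sum_mangoldt] gives [mangoldt n] as the sum of [moebius d * lg (n %/ d)].
    Then [lg (n %/ d) = lg n - lg d], and the part with [lg n] vanishes, for [n = 1] because
    [lg 1 = 0]. *)
Lemma sum_moebius_lg n : (0 < n)%N ->
  \sum_(1 <= d < n.+1 | (d %| n)%N) moebius d * lg d = - mangoldt n.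
Proof.
move=> n0.
have inv : \sum_(1 <= d < n.+1 | (d %| n)%N) moebius d * lg (n %/ d) = mangoldt n.
  transitivity (\sum_(1 <= d < n.+1) \sum_(1 <= e < n.+1 | (d * e %| n)%N)
      moebius d * mangoldt e).
    rewrite big_mkcond big_seq [RHS]big_seq; apply: eq_bigr => d.
    rewrite mem_index_iota => /andP[d0 dn]; case: ifP => dvd.
      have q0 : (0 < n %/ d)%N by rewrite divn_gt0 // -ltnS.
      rewrite -sum_mangoldt // mulr_sumr -[LHS](@dsum_widen _ _ _ n).
        by apply: eq_bigl => e; rewrite dvdn_divRL // mulnC.
      by rewrite q0 leq_div.
    rewrite big_pred0 // => e; apply/negP => h.
    by move: dvd; rewrite (dvdn_trans _ h) // dvdn_mulr.
  rewrite (exchange_big_dep_nat xpredT) //=.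
  transitivity (\sum_(1 <= e < n.+1 | (e %| n)%N) (n %/ e == 1)%N%:R * mangoldt e).
    rewrite [RHS]big_mkcond big_seq [RHS]big_seq; apply: eq_bigr => e.
    rewrite mem_index_iota => /andP[e0 en]; case: ifP => dvd.
      have q0 : (0 < n %/ e)%N by rewrite divn_gt0 // -ltnS.
      rewrite -sum_moebius // mulr_suml -[RHS](@dsum_widen _ _ _ n).
        by apply: eq_bigl => d; rewrite dvdn_divRL // mulnC.
      by rewrite q0 leq_div.
    rewrite big_pred0 // => d; apply/negP => h.
    by move: dvd; rewrite (dvdn_trans _ h) // dvdn_mull.
  rewrite big_mkcond big_nat_recr //= dvdnn divnn n0 mul1r big1_seq ?add0r // => e /=.
  rewrite mem_index_iota => /andP[e0 en]; case: ifP => // dvd.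
  suff /negPf -> : (n %/ e != 1)%N by rewrite mul0r.
  by apply/eqP => h; move: (divnK dvd); rewrite h mul1n => h'; rewrite h' ltnn in en.
have h : mangoldt n + \sum_(1 <= d < n.+1 | (d %| n)%N) moebius d * lg d =
    lg n * \sum_(1 <= d < n.+1 | (d %| n)%N) moebius d.
  rewrite -inv -big_split /= mulr_sumr big_seq_cond [RHS]big_seq_cond.
  apply: eq_bigr => d; rewrite mem_index_iota => /andP[/andP[d0 dn] dvd].
  have q0 : (0 < n %/ d)%N by rewrite divn_gt0 // -ltnS.
  by rewrite -mulrDr -lgM // divnK // mulrC.
apply/eqP; rewrite -addr_eq0 addrC h sum_moebius //.
by have [->|_] := eqVneq n 1%N; rewrite ?lg1 ?mul0r ?mulr0.
Qed.

Lemma inv_divn_le d N : (0 < d <= N)%N -> (N %/ d)%:R^-1 <= 2 * d%:R / N%:R :> R.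
Proof.
move=> /andP[d0 dN]; have N0 := leq_trans d0 dN.
have q0 : (0 < N %/ d)%N by rewrite divn_gt0.
have nr : 0 < N%:R :> R by rewrite ltr0n.
have qr : 0 < (N %/ d)%:R :> R by rewrite ltr0n.
rewrite ler_pdivlMr // mulrC ler_pdivrMr // -natrM -natrM ler_nat.
have := ltn_ceil N d0; set q := (N %/ d)%N in q0 *; nia.
Qed.

Lemma sum_lg_diff N :
  \sum_(1 <= d < N.+1) (lg N - lg d) <= N%:R.
Proof.
have /andP[h _] := sum_lg_bounds N.
rewrite sumrB sumr_const_nat subn1 /= -mulr_natl; lra.
Qed.

Lemma sum_lg_sq N : \sum_(2 <= n < N.+1) lg n / n%:R ^+ 2 <= 2.
Proof.
case: N => [|N]; first by rewrite big_geq.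
(* The tail of the integral of [log t / t^2] from [x] on is [(log x + 1) / x]. With 2 in place of 1
   the induction step already holds from [x = 1] on. *)
suff h : \sum_(2 <= n < N.+2) lg n / n%:R ^+ 2 <= 2 - (lg N.+1 + 2) / N.+1%:R.
  apply: le_trans h _; rewrite gerBl; apply: divr_ge0 => //.
  by apply: addr_ge0 => //; exact: lg_ge0.
elim: N => [|N IH]; first by rewrite big_geq // lg1; lra.
rewrite big_nat_recr //=; apply: le_trans (lerD IH (lexx _)) _.
have h1 := lgS_ub (n := N.+1) isT; have l0 := lg_ge0 N.+2.
have x1 : 1 <= N.+1%:R :> R by rewrite ler1n.
have -> : N.+2%:R = N.+1%:R + 1 :> R by rewrite natr1.
move: h1 l0 x1; move: (lg N.+2) (lg N.+1) (N.+1%:R : R) => a b x h1 a0 x1.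
have x0 : 0 < x by lra.
have h2 : a - x^-1 <= b by rewrite lerBlDr -lerBlDl.
have h3 : (a - x^-1 + 2) / x <= (b + 2) / x by rewrite ler_pM2r ?invr_gt0 //; lra.
suff : a / (x + 1) ^+ 2 + (a + 2) / (x + 1) <= (a - x^-1 + 2) / x by lra.
rewrite -subr_ge0.
have -> : (a - x^-1 + 2) / x - (a / (x + 1) ^+ 2 + (a + 2) / (x + 1)) =
  (a * x + (x ^+ 2 - 1)) / (x ^+ 2 * (x + 1) ^+ 2).
  by field; rewrite !gt_eqF //; lra.
by apply: divr_ge0; [nra | apply: mulr_ge0; exact: sqr_ge0].
Qed.

(** Only the powers [p ^ j] with [1 < j] contribute. As [2 <= p], the geometric series in [j] is at
    most [2 / p^2], and [sum_lg_sq], taken over all integers [p] from 2 on, supplies the other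
    factor 2. *)
Lemma sum_mangoldt_nonprime N :
  \sum_(1 <= d < N.+1 | ~~ prime d) mangoldt d / d%:R <= 4.
Proof.
pose T (p j : nat) := lg p / (p ^ j)%:R.
have T0 p j : 0 <= T p j by apply: divr_ge0 => //; exact: lg_ge0.
have step d : (1 <= d < N.+1)%N -> ~~ prime d ->
    mangoldt d / d%:R <=
    \sum_(2 <= p < N.+1) \sum_(2 <= j < N.+1) (if d == (p ^ j)%N then T p j else 0).
  move=> /andP[d0 dN] npd; have [->|] := eqVneq (mangoldt d) 0.
    by rewrite mul0r; apply: sumr_ge0 => p _; apply: sumr_ge0 => j _; case: ifP.
  rewrite {1}/mangoldt; case E : (primes d) => [|p [|q s]]; rewrite ?eqxx // => _.
  have pin : p \in primes d by rewrite E inE.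
  have [pp _ pd] : [/\ prime p, (0 < d)%N & (p %| d)%N] by apply/and3P; rewrite -mem_primes.
  have dE : d = (p ^ logn p d)%N.
    by rewrite {1}[d]prod_prime_decomp // prime_decompE E /= big_seq1.
  set j := logn p d in dE.
  have j0 : (0 < j)%N by rewrite logn_gt0.
  have j2 : (1 < j)%N.
    by rewrite ltn_neqAle j0 andbT; apply/eqP => j1; move: npd; rewrite dE -j1 expn1 pp.
  have jN : (j < N.+1)%N.
    by apply: leq_ltn_trans dN; rewrite [leqRHS]dE ltnW // ltn_expl // prime_gt1.
  have pN : (p < N.+1)%N by apply: leq_ltn_trans dN; exact: dvdn_leq.
  have pI : p \in index_iota 2 N.+1 by rewrite mem_index_iota prime_gt1.
  have jI : j \in index_iota 2 N.+1 by rewrite mem_index_iota j2.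
  rewrite (bigD1_seq p) ?iota_uniq //= (bigD1_seq j) ?iota_uniq //= -dE eqxx.
  have -> : T p j = mangoldt d / d%:R by rewrite /T /mangoldt E dE.
  rewrite -addrA lerDl; apply: addr_ge0; first by apply: sumr_ge0 => i _; case: ifP.
  by apply: sumr_ge0 => i _; apply: sumr_ge0 => k _; case: ifP.
have -> : 4 = 2 * 2 :> R by lra.
apply: le_trans (_ : 2 * (\sum_(2 <= p < N.+1) lg p / p%:R ^+ 2) <= _); last first.
  by rewrite ler_pM2l // sum_lg_sq.
apply: le_trans (_ : \sum_(1 <= d < N.+1) \sum_(2 <= p < N.+1) \sum_(2 <= j < N.+1)
   (if d == (p ^ j)%N then T p j else 0) <= _).
  rewrite big_mkcond big_seq [leRHS]big_seq; apply: ler_sum => d.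
  rewrite mem_index_iota => hd; case: ifP => npd; first exact: step.
  by apply: sumr_ge0 => p _; apply: sumr_ge0 => j _; case: ifP.
rewrite exchange_big mulr_sumr /= big_seq [leRHS]big_seq; apply: ler_sum => p.
rewrite mem_index_iota => /andP[p2 _]; rewrite exchange_big /=.
apply: le_trans (_ : \sum_(2 <= j < N.+1) T p j <= _).
  apply: ler_sum => j _; rewrite -big_mkcond.
  by rewrite (big_nat1_eq _ (fun=> T p j)); case: ifP => _; rewrite ?lexx.
have p0 : 0 < p%:R :> R by rewrite ltr0n ltnW.
have p2r : 2 <= p%:R :> R by rewrite (ler_nat R 2).
rewrite /T; under eq_bigr do rewrite natrX.
rewrite -mulr_sumr mulrCA; apply: ler_wpM2l; first exact: lg_ge0.
case: (leqP N.+1 2) => [le|lt].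
  by rewrite big_geq //; apply: mulr_ge0 => //; rewrite invr_ge0 sqr_ge0.
suff : \sum_(2 <= j < N.+1) (p%:R ^+ j)^-1 <= 2 / p%:R ^+ 2 - 2 / p%:R ^+ N.+1 :> R.
  have : 0 <= 2 / p%:R ^+ N.+1 :> R by apply: divr_ge0 => //; exact: exprn_ge0.
  lra.
move/ltnW: lt; elim: N {step} => // N IH; rewrite leq_eqVlt => /orP[/eqP<-|lt].
  by rewrite big_geq // subrr.
rewrite big_nat_recr //=; apply: le_trans (lerD (IH lt) (lexx _)) _.
have -> : (p%:R ^+ N.+1)^-1 = p%:R / p%:R ^+ N.+2 :> R.
  by rewrite [_ ^+ N.+2]exprS invfM mulrA divff ?mul1r // gt_eqF.
have x0 : 0 < (p%:R ^+ N.+2)^-1 :> R by rewrite invr_gt0 exprn_gt0.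
have : 2 * (p%:R ^+ N.+2)^-1 <= p%:R / p%:R ^+ N.+2 :> R by rewrite ler_pM2r.
set u := p%:R / _; set v := (p%:R ^+ N.+2)^-1; set w := 2 / p%:R ^+ 2; lra.
Qed.

(** * Dirichlet characters *)

(** In characteristic 0 the polynomial [X^n - 1] is separable, so it has [n] distinct roots; the
    cyclic group that they form has a generator. *)
Lemma prim_root_exists (C : numClosedFieldType) n : (0 < n)%N ->
  exists z : C, n.-primitive_root z.
Proof.
move=> n0; have [r pE] := closed_field_poly_normal ('X^n - 1 : {poly C}).
rewrite (monicP (monicXnsubC 1 n0)) scale1r in pE.
have unit_r : all n.-unity_root r.
  by apply/allP => z zr; rewrite /root_of_unity pE root_prod_XsubC.
have uniq_r : uniq r.
  by rewrite -separable_prod_XsubC -pE separable_Xn_sub_1 // pnatr_eq0 -lt0n.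
have size_r : (n <= size r)%N.
  by rewrite -ltnS -(size_prod_XsubC r id) -pE size_XnsubC.
by have /hasP[z _ ?] := has_prim_root n0 unit_r uniq_r size_r; exists z.
Qed.

Section DualGroup.
Variables (gT : finGroupType) (n : nat).
Hypotheses (abG : abelian [set: gT]) (cardG : #|gT| = n.+1).
Implicit Types (e : {ffun gT -> 'I_n.+1}) (g h : gT).

Definition additive_exponent e := [forall g, forall h, e (g * h)%g == e g + e h].

Lemma additive_exponentP e :
  reflect (forall g h, e (g * h)%g = e g + e h) (additive_exponent e).
Proof.
by apply: (iffP forallP) => H g; [move=> h; have /forallP/(_ h)/eqP := H g
                                 |apply/forallP => h; apply/eqP].
Qed.

(* The values of a linear character of gT are powers of a primitive
   #|gT|-th root of unity; recording only the exponents moves characters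
   from algC to any other field with such a root. *)
Lemma exponent_separates g : g != 1%g -> exists2 e, additive_exponent e & e g != 0.
Proof.
move=> g1.
have [i lin_i ker_i] : exists2 i, 'chi[[set: gT]]_i \is a linear_char & g \notin cfker 'chi_i.
  apply/exists_inP; rewrite -[X in is_true X]negbK negb_exists_in.
  apply/negP => /forall_inP H; case/negP: g1.
  have : g \in \bigcap_(i | 'chi[[set: gT]]_i \is a linear_char) cfker 'chi_i.
    by apply/bigcapP => i /H; rewrite negbK.
  by rewrite cap_cfker_lin_irr (derG1P abG) inE.
have [z prim_z] := C_prim_root_exists (ltn0Sn n).
have chi_root h : 'chi_i h ^+ n.+1 = 1.
  have /dvdnP[k ->] : (#[h]%g %| n.+1)%N by rewrite -cardG -cardsT order_dvdG ?inE.
  by rewrite mulnC exprM (lin_char_unity_root lin_i) ?inE // expr1n.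
pose e : {ffun gT -> 'I_n.+1} := [ffun h => sval (prim_rootP prim_z (chi_root h))].
have eE h : 'chi_i h = z ^+ e h by rewrite ffunE; case: prim_rootP.
exists e.
  apply/additive_exponentP => h k; apply/val_inj => /=; apply/eqP.
  rewrite -[eqbLHS](@modn_small _ n.+1) ?ltn_ord // -(eq_prim_root_expr prim_z) -eE.
  by rewrite (lin_charM lin_i) ?inE // !eE exprD.
apply: contraNneq ker_i => eg0.
by rewrite cfkerEchar ?lin_charW // !inE (lin_char1 lin_i) eE eg0 expr0 eqxx.
Qed.

Definition exponent := {e | additive_exponent e}.

Lemma exponentM (e : exponent) g h : val e (g * h)%g = val e g + val e h.
Proof. by case: e => e /= /additive_exponentP. Qed.

Lemma additive_exponent0 : additive_exponent 0.
Proof. by apply/additive_exponentP => g h; rewrite !ffunE addr0. Qed.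

Lemma additive_exponentD e f :
  additive_exponent e -> additive_exponent f -> additive_exponent (e + f).
Proof.
move=> /additive_exponentP E /additive_exponentP F.
by apply/additive_exponentP => g h; rewrite !ffunE E F addrACA.
Qed.

Lemma additive_exponentN e : additive_exponent e -> additive_exponent (- e).
Proof.
move=> /additive_exponentP E.
by apply/additive_exponentP => g h; rewrite !ffunE E opprD.
Qed.

Definition exponent0 : exponent := exist _ 0 additive_exponent0.
Definition exponentD (e f : exponent) : exponent :=
  exist _ (val e + val f) (additive_exponentD (valP e) (valP f)).
Definition exponentN (e : exponent) : exponent :=
  exist _ (- val e) (additive_exponentN (valP e)).

Variables (C : numClosedFieldType) (w : C).
Hypothesis prim_w : n.+1.-primitive_root w.

Lemma expr_addI (a b : 'I_n.+1) : w ^+ (a + b)%R = w ^+ a * w ^+ b.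
Proof. by rewrite /= prim_expr_mod // exprD. Qed.

Lemma expr_eq1I (a : 'I_n.+1) : (w ^+ a == 1) = (a == 0).
Proof.
rewrite -(expr0 w) (eq_prim_root_expr prim_w) mod0n modn_small ?ltn_ord //.
Qed.

Lemma exponent_sum1 (e : exponent) : e != exponent0 -> \sum_g w ^+ val e g = 0.
Proof.
move=> e0; have [g eg] : exists g, val e g != 0.
  apply/existsP; rewrite -negb_forall; apply: contra e0 => /forallP H.
  by apply/eqP/val_inj/ffunP => g; rewrite !ffunE; apply/eqP.
have : (w ^+ val e g - 1) * (\sum_g w ^+ val e g) = 0.
  rewrite mulrBl mul1r mulr_sumr [X in _ - X](reindex_inj (mulgI g)) /=.
  by apply/eqP; rewrite subr_eq0; apply/eqP/eq_bigr => h _; rewrite exponentM expr_addI.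
by move/eqP; rewrite mulf_eq0 subr_eq0 expr_eq1I (negPf eg) => /eqP.
Qed.

(** Adding an exponent that is nonzero at [g] permutes the exponents and multiplies the sum by a
    number other than 1. *)
Lemma exponent_sum2 g : g != 1%g -> \sum_(e : exponent) w ^+ val e g = 0.
Proof.
move=> g1; have [e ade eg] := exponent_separates g1; pose f : exponent := exist _ e ade.
have inj : injective (exponentD f).
  by move=> x y /(congr1 val) /= /addrI /val_inj.
have : (w ^+ val f g - 1) * (\sum_(e : exponent) w ^+ val e g) = 0.
  rewrite mulrBl mul1r mulr_sumr [X in _ - X](reindex_inj inj) /=.
  apply/eqP; rewrite subr_eq0; apply/eqP/eq_bigr => h _.
  by rewrite ffunE expr_addI.
by move/eqP; rewrite mulf_eq0 subr_eq0 expr_eq1I (negPf eg) => /eqP.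
Qed.

Lemma exponent1 (e : exponent) : val e 1%g = 0.
Proof. by have /eqP := exponentM e 1 1; rewrite mulg1 addrC -subr_eq subrr => /eqP. Qed.

(** Both orthogonality relations evaluate the same double sum: summed over [g] first it is the order
    of the group, summed over [e] first it is the number of exponents. *)
Lemma card_exponent : #|{: exponent}| = n.+1.
Proof.
apply/eqP; rewrite -(eqr_nat C); apply/eqP.
have : \sum_(e : exponent) \sum_g w ^+ val e g = \sum_g \sum_(e : exponent) w ^+ val e g.
  exact: exchange_big.
rewrite (bigD1 exponent0) //= [X in _ + X]big1 => [|e e0]; last exact: exponent_sum1.
rewrite [in RHS](bigD1 1%g) //= [X in _ = _ + X -> _]big1 => [|g g1]; last exact: exponent_sum2.
rewrite !addr0; under eq_bigr do rewrite ffunE expr0.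
under [in RHS]eq_bigr do rewrite exponent1 expr0.
by rewrite !sumr_const cardG => <-.
Qed.

End DualGroup.

(** All that the analytic part knows of the characters mod [m], extended by 0 to every natural
    number. [chi_norm] states at once where a character vanishes and that its other values are
    unimodular; [chi_sum] and [chi_dual] are the two orthogonality relations. *)
Record dirichlet_characters (m : nat) := DirichletCharacters {
  dchar :> finType;
  dchar0 : dchar;
  dcharN : dchar -> dchar;
  chi : dchar -> nat -> R[i];
  chiM : forall x a b, chi x (a * b)%N = chi x a * chi x b;
  chi_mod : forall x a, chi x (a %% m)%N = chi x a;
  chi_norm : forall x a, normc (chi x a) = (coprime a m)%:R;
  chi_principal : forall a, chi dchar0 a = (coprime a m)%:R;
  chi_sum : forall x, x != dchar0 -> \sum_(0 <= a < m) chi x a = 0;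
  chiN : forall x a, chi (dcharN x) a = (chi x a)^*%C;
  chi_dual : forall a, coprime a m ->
    \sum_x chi x a = ((a == 1 %[mod m]) * totient m)%N%:R }.

(** The modulus 1 is treated apart because ['Z_1] has two elements in MathComp, so units of ['Z_m]
    model the residues only for [1 < m]. *)
Lemma characters_mod1 : inhabited (dirichlet_characters 1).
Proof.
split; apply: (@DirichletCharacters 1 unit tt id (fun _ _ => 1)) => //.
- by move=> x a b; rewrite mulr1.
- by move=> x a; rewrite normc1 coprimen1.
- by move=> a; rewrite coprimen1.
- by move=> x a; rewrite rmorph1.
- by move=> a _; rewrite sumr_const card_unit !modn1 eqxx mul1n.
Qed.

Lemma normc_ge0 (z : R[i]) : 0 <= normc z.
Proof. by case: z => a b /=; exact: sqrtr_ge0. Qed.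

Lemma normcX (z : R[i]) k : normc (z ^+ k) = normc z ^+ k.
Proof. by elim: k => [|k IH]; rewrite ?expr0 ?normc1 // !exprS normcM IH. Qed.

Lemma characters_exist m : (1 < m)%N -> inhabited (dirichlet_characters m).
Proof.
move=> m1; have m0 := ltnW m1.
have abG : abelian [set: {unit 'Z_m}] := units_Zp_abelian m.
have cardT : #|{: {unit 'Z_m}}| = totient m by rewrite -cardsT -(card_units_Zp m0).
have [n nE] : exists n, totient m = n.+1.
  by exists (totient m).-1; rewrite prednK // totient_gt0.
have cardG : #|{: {unit 'Z_m}}| = n.+1 by rewrite cardT.
have [w prim_w] := @prim_root_exists R[i] _ (ltn0Sn n).
have normw : normc w = 1.
  apply/eqP; rewrite -(@pexpr_eq1 _ _ n.+1) ?normc_ge0 //.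
  by rewrite -normcX (prim_expr_order prim_w) normc1.
have conjw k : (w ^+ k)^*%C * w ^+ k = 1.
  rewrite mulrC -sqr_normc -[`|_|]/((normc (w ^+ k))%:C)%C normcX normw expr1n.
  by rewrite rmorph1 expr1n.
(* When [a] is not prime to [m], [u a] is the dummy value 1, which the test in [F] masks. *)
pose u (a : nat) : {unit 'Z_m} := insubd (1%g : {unit 'Z_m}) (a%:R : 'Z_m).
have uE a : coprime a m -> val (u a) = a%:R.
  by move=> ca; rewrite insubdK // -topredE /= unitZpE // coprime_sym.
have uM a b : coprime a m -> coprime b m -> u (a * b)%N = (u a * u b)%g.
  move=> ca cb; apply: val_inj; rewrite [RHS]/= uE ?coprimeMl ?ca // natrM.
  by rewrite -(uE _ ca) -(uE _ cb).
have umod a : u (a %% m)%N = u a by rewrite /u Zp_nat_mod.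
have u_surj g : exists2 b, coprime b m & u b = g.
  have vg : (val g : 'Z_m)%:R = val g :> 'Z_m := natr_Zp _.
  have cg : coprime (val g : 'Z_m) m.
    by rewrite coprime_sym -unitZpE // vg; exact: valP.
  by exists (val g : 'Z_m) => //; apply: val_inj; rewrite uE.
have u1 a : coprime a m -> (u a == 1%g) = (a == 1 %[mod m]).
  move=> ca; rewrite -(inj_eq val_inj) /= uE // -(inj_eq val_inj) /=.
  by rewrite val_Zp_nat // Zp_cast.
pose I := exponent {unit 'Z_m} n.
pose F (x : I) a : R[i] := if coprime a m then w ^+ val x (u a) else 0.
have FM x a b : F x (a * b)%N = F x a * F x b.
  rewrite /F coprimeMl; case: (boolP (coprime a m)) => ca /=; last by rewrite mul0r.
  case: (boolP (coprime b m)) => cb /=; last by rewrite mulr0.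
  by rewrite uM // exponentM (expr_addI prim_w).
have Fmod x a : F x (a %% m)%N = F x a by rewrite /F coprime_modl umod.
split; apply: (@DirichletCharacters m I (exponent0 _ n) (@exponentN _ n) F) => //.
- move=> x a; rewrite /F; case: ifP => ca; last by rewrite normc0.
  by rewrite normcX normw expr1n.
- by move=> a; rewrite /F; case: ifP => //; rewrite ffunE expr0.
- move=> x x0; have [g xg] : exists g, val x g != 0.
    apply/existsP; rewrite -negb_forall; apply: contra x0 => /forallP H.
    by apply/eqP/val_inj/ffunP => g; rewrite !ffunE; apply/eqP.
  have [b cb ub] := u_surj g; rewrite big_mkord.
  (* Multiplication by [b] permutes all residues, so the sum over a period is unchanged when
     multiplied by [F x b], which is not 1. *)
  pose h (a : 'I_m) : 'I_m := Ordinal (ltn_pmod (b * a) m0).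
  have inj_h : injective h.
    move=> a c /(congr1 val) /= bac; apply: val_inj => /=.
    have : (b * a)%:R = (b * c)%:R :> 'Z_m by rewrite -Zp_nat_mod // bac Zp_nat_mod.
    have ub_unit : (b%:R : 'Z_m) \is a GRing.unit by rewrite unitZpE // coprime_sym.
    rewrite !natrM => /(mulrI ub_unit) /(congr1 val) /=.
    by rewrite !val_Zp_nat // !modn_small.
  have : (F x b - 1) * (\sum_(a < m) F x a) = 0.
    rewrite mulrBl mul1r mulr_sumr [X in _ - X](reindex_inj inj_h) /=.
    apply/eqP; rewrite subr_eq0; apply/eqP/eq_bigr => a _.
    by rewrite Fmod FM.
  move/eqP; rewrite mulf_eq0 subr_eq0 /F cb ub (expr_eq1I prim_w) (negPf xg) /=.
  by move/eqP.
- move=> x a; rewrite /F; case: ifP => ca; last by rewrite rmorph0.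
  have w0 k : w ^+ k != 0.
    apply: expf_neq0; apply/eqP => w0; have := prim_expr_order prim_w.
    by rewrite w0 expr0n /= => /eqP; rewrite eq_sym oner_eq0.
  apply: (mulIf (w0 (val x (u a)))); rewrite conjw -(expr_addI prim_w).
  by rewrite ffunE addNr expr0.
- move=> a ca; under eq_bigr do rewrite /F ca.
  have [ua|ua] := eqVneq (u a) 1%g; rewrite -u1 //.
    under eq_bigr do rewrite ua exponent1 expr0.
    by rewrite sumr_const (card_exponent abG cardG prim_w) nE ua eqxx mul1n.
  by rewrite (exponent_sum2 abG cardG prim_w ua) (negPf ua) mul0n.
Qed.

(** * Sums twisted by a character *)

Lemma normc_real (x : R) : normc x%:C = `|x|.
Proof. by rewrite /= expr0n addr0 sqrtr_sqr. Qed.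

Lemma normcMr (x : R) (z : R[i]) : normc (x%:C * z) = `|x| * normc z.
Proof. by rewrite normcM normc_real. Qed.

Lemma normcD (x y : R[i]) : normc (x + y) <= normc x + normc y.
Proof. exact: le_normcD. Qed.

Lemma normcB (x y : R[i]) : normc (x - y) <= normc x + normc y.
Proof. by rewrite -[normc y]normcN; exact: le_normcD. Qed.

Lemma normc_sum (I : Type) (r : seq I) (P : pred I) (F : I -> R[i]) :
  normc (\sum_(i <- r | P i) F i) <= \sum_(i <- r | P i) normc (F i).
Proof.
elim/big_rec2: _ => [|i x y _ h]; first by rewrite normc0.
by apply: le_trans (normcD _ _) _; rewrite lerD2l.
Qed.

Lemma normc_le_ReIm (z : R[i]) : normc z <= `|complex.Re z| + `|complex.Im z|.
Proof.
case: z => a b /=; have -> : `|a| + `|b| = Num.sqrt ((`|a| + `|b|) ^+ 2).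
  by rewrite sqrtr_sqr [RHS]ger0_norm //; exact: addr_ge0.
apply: ler_wsqrtr; rewrite sqrrD !real_normK ?num_real // lerD2r lerDl.
by rewrite mulrn_wge0 // mulr_ge0.
Qed.

Lemma normc_geRe (z : R[i]) : `|complex.Re z| <= normc z.
Proof.
case: z => a b /=; rewrite -sqrtr_sqr; apply: ler_wsqrtr.
by rewrite lerDl sqr_ge0.
Qed.

Lemma normc_geIm (z : R[i]) : `|complex.Im z| <= normc z.
Proof.
case: z => a b /=; rewrite -sqrtr_sqr; apply: ler_wsqrtr.
by rewrite lerDr sqr_ge0.
Qed.

(** Summation by parts. The induction bounds the weighted sum minus its boundary term, [f n] times
    the partial sum of [c]: each step costs at most [B * (f n - f n.+1)], which telescopes. The
    boundary term then gives back [B * f b]. *)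
Lemma abel_bound (c : nat -> R[i]) (f : nat -> R) a b B : (a <= b)%N ->
  (forall n, (a <= n)%N -> 0 <= f n.+1 <= f n) -> 0 <= f a ->
  (forall n, (a <= n <= b)%N -> normc (\sum_(a <= i < n) c i) <= B) ->
  normc (\sum_(a <= i < b) (f i)%:C * c i) <= B * f a.
Proof.
move=> ab fdec fa0 cB.
have B0 : 0 <= B by have := cB a; rewrite leqnn ab big_geq // normc0; exact.
have f0 n : (a <= n)%N -> 0 <= f n.
  by rewrite leq_eqVlt => /orP[/eqP<-//|]; case: n => // n /fdec /andP[].
have key n : (a <= n <= b)%N ->
    normc (\sum_(a <= i < n) (f i)%:C * c i - (f n)%:C * \sum_(a <= i < n) c i)
      <= B * (f a - f n).
  elim: n => [|n IH] /andP[an nb].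
    by move: an; rewrite leqn0 => /eqP ->; rewrite !big_geq // mulr0 subr0 normc0 subrr mulr0.
  move: an; rewrite leq_eqVlt => /orP[/eqP<-|an].
    by rewrite !big_geq // mulr0 subr0 normc0 subrr mulr0.
  rewrite ltnS in an.
  have {}IH := IH (introT andP (conj an (ltnW nb))).
  have cn := cB n.+1 (introT andP (conj (leqW an) nb)).
  have -> : \sum_(a <= i < n.+1) (f i)%:C * c i - (f n.+1)%:C * \sum_(a <= i < n.+1) c i
     = (\sum_(a <= i < n) (f i)%:C * c i - (f n)%:C * \sum_(a <= i < n) c i)
       + (f n - f n.+1)%:C * \sum_(a <= i < n.+1) c i.
    by rewrite !(big_nat_recr n) //= rmorphB /=; ring.
  apply: le_trans (normcD _ _) _; rewrite normcMr.
  have /andP[_ h] := fdec n an.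
  rewrite ger0_norm ?subr_ge0 //.
  have : (f n - f n.+1) * normc (\sum_(a <= i < n.+1) c i) <= (f n - f n.+1) * B.
    by apply: ler_wpM2l => //; rewrite subr_ge0.
  move: IH; rewrite !mulrBr !mulrBl; lra.
have bI : (a <= b <= b)%N by rewrite ab leqnn.
have := key b bI; have := cB b bI; have fb := f0 b ab.
set s := \sum_(a <= i < b) c i; set t := \sum_(a <= i < b) _ => h1 h2.
have -> : t = (t - (f b)%:C * s) + (f b)%:C * s by rewrite subrK.
apply: le_trans (normcD _ _) _; rewrite normcMr ger0_norm //.
have : f b * normc s <= f b * B by apply: ler_wpM2l.
move: h2; rewrite mulrBr; lra.
Qed.

(* No rate is required of [e]: the limit is the supremum of [u n - e n]. *)
Lemma cauchy_limit (u e : nat -> R) : (forall n, 0 <= e n) ->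
  (forall n m, (n <= m)%N -> `|u m - u n| <= e n) ->
  exists l, forall n, `|l - u n| <= e n.
Proof.
move=> e0 ue.
pose E (x : R) := exists n, x = u n - e n.
have ub m x : E x -> x <= u m + e m.
  move=> [n ->]; case: (leqP n m) => [nm|/ltnW mn].
    by have := ue _ _ nm; have := e0 m; rewrite ler_norml => ? /andP[]; lra.
  by have := ue _ _ mn; have := e0 n; rewrite ler_norml => ? /andP[]; lra.
have [||l [l1 l2]] := Raxioms.completeness E.
- by exists (u 0 + e 0) => x Ex; apply/RleP; exact: (ub 0%N x Ex).
- by exists (u 0 - e 0); exists 0%N.
exists l => n; rewrite ler_norml.
have /RleP h1 := l1 (u n - e n) (ex_intro _ n erefl).
have /RleP h2 : Rdefinitions.Rle l (u n + e n).
  by apply: l2 => x Ex; apply/RleP; exact: ub.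
by apply/andP; split; lra.
Qed.

Lemma cauchy_limitC (u : nat -> R[i]) (e : nat -> R) : (forall n, 0 <= e n) ->
  (forall n m, (n <= m)%N -> normc (u m - u n) <= e n) ->
  exists l, forall n, normc (l - u n) <= 2 * e n.
Proof.
move=> e0 ue.
have [|a ha] := @cauchy_limit (fun n => complex.Re (u n)) e e0.
  move=> n m nm; apply: le_trans (ue _ _ nm).
  by have := normc_geRe (u m - u n); rewrite raddfB.
have [|b hb] := @cauchy_limit (fun n => complex.Im (u n)) e e0.
  move=> n m nm; apply: le_trans (ue _ _ nm).
  by have := normc_geIm (u m - u n); rewrite raddfB.
exists (a +i* b) => n; apply: le_trans (normc_le_ReIm _) _.
have := ha n; have := hb n; rewrite !raddfB /=; lra.
Qed.

Section TwistedSums.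
Variables (m : nat) (c : nat -> R[i]).
Hypotheses (m0 : (0 < m)%N) (cM : forall a b, c (a * b)%N = c a * c b)
  (cmod : forall a, c (a %% m)%N = c a) (c_le1 : forall a, normc (c a) <= 1)
  (csum : \sum_(0 <= a < m) c a = 0).

Definition twist (f : nat -> R) N := \sum_(1 <= n < N.+1) (f n)%:C * c n.

Lemma sum_modn N : \sum_(0 <= a < N) c a = \sum_(0 <= a < N %% m) c a.
Proof.
elim/ltn_ind: N => N IH; have [lt|le] := ltnP N m; first by rewrite modn_small.
rewrite (big_cat_nat (n := m)) //= csum add0r -{1}[m]add0n big_addn.
under eq_bigr do rewrite -cmod modnDr cmod.
by rewrite IH ?ltn_subrL ?m0 ?(leq_trans m0) // -{2}(subnK le) modnDr.
Qed.

Lemma sum_bounded a b : (a <= b)%N -> normc (\sum_(a <= i < b) c i) <= 2 * m%:R.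
Proof.
have init N : normc (\sum_(0 <= i < N) c i) <= m%:R.
  rewrite sum_modn; apply: le_trans (normc_sum _ _ _) _.
  apply: le_trans (ler_sum _ (fun i _ => c_le1 i)) _.
  by rewrite sumr_const_nat subn0 ler_nat ltnW // ltn_pmod.
move=> ab; have -> : \sum_(a <= i < b) c i = \sum_(0 <= i < b) c i - \sum_(0 <= i < a) c i.
  by rewrite (big_cat_nat (m := 0) (n := a) (p := b)) //= addrAC subrr add0r.
by apply: le_trans (normcB _ _) _; have := init a; have := init b; lra.
Qed.

Lemma twisted_tail (f : nat -> R) a b : (a <= b)%N ->
  (forall n, (a <= n)%N -> 0 <= f n.+1 <= f n) -> 0 <= f a ->
  normc (\sum_(a <= i < b) (f i)%:C * c i) <= 2 * m%:R * f a.
Proof.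
move=> ab fdec fa; apply: abel_bound => // n /andP[an _].
exact: sum_bounded.
Qed.

Lemma inv_decreasing n : (0 < n)%N -> 0 <= (n.+1%:R^-1 : R) <= n%:R^-1.
Proof.
by move=> n0; rewrite invr_ge0 ler0n /= lef_pV2 ?posrE ?ltr0n // ler_nat.
Qed.

(** A tail is at most [2 * m] times its first weight; taking limits separately in the real and the
    imaginary part doubles this constant. *)
Lemma L_exists : exists L : R[i], forall N, (0 < N)%N ->
  normc (L - twist (fun n => n%:R^-1) N) <= 4 * m%:R / N%:R.
Proof.
pose u N := twist (fun n => n%:R^-1) N.+1.
have [||L hL] := @cauchy_limitC u (fun N => 2 * m%:R / N.+1%:R).
- by move=> n; apply: divr_ge0 => //; apply: mulr_ge0.
- move=> a b ab; rewrite /u /twist (big_cat_nat (n := a.+2) (p := b.+2)) //=.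
  rewrite addrAC subrr add0r.
  apply: le_trans (twisted_tail _ _ _) _ => //.
  + by move=> n an; apply: inv_decreasing; apply: leq_trans an.
  + by rewrite invr_ge0.
  + by apply: ler_wpM2l; [apply: mulr_ge0|have /andP[] := inv_decreasing (ltn0Sn a)].
exists L => -[//|N] _; apply: le_trans (hL N) _.
by rewrite !mulrA; apply: ler_wpM2r; [by rewrite invr_ge0|lra].
Qed.

(** By complete multiplicativity [c n = c d * c (n %/ d)], so twisting a Dirichlet convolution
    yields shorter twisted sums, one for each [d]. *)
Lemma twist_convolution (g h : nat -> R) N :
  \sum_(1 <= n < N.+1)
     (\sum_(1 <= d < n.+1 | (d %| n)%N) g d * h (n %/ d)%N)%:C * c n
  = \sum_(1 <= d < N.+1) (g d)%:C * c d * twist h (N %/ d).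
Proof.
transitivity (\sum_(1 <= n < N.+1) \sum_(1 <= d < n.+1 | (d %| n)%N)
    (fun d q : nat => (g d)%:C * c d * ((h q)%:C * c q)) d (n %/ d)%N).
  apply: eq_bigr => n _; rewrite rmorph_sum mulr_suml; apply: eq_bigr => d dn /=.
  by rewrite rmorphM mulrACA -cM [(d * _)%N]mulnC divnK.
rewrite (dirichlet_sum (fun d q : nat => (g d)%:C * c d * ((h q)%:C * c q))).
by apply: eq_bigr => d _; rewrite /twist mulr_sumr.
Qed.

(** The function [log t / t] decreases from [e] on, and [e <= 3]. *)
Lemma lg_div_decreasing n : (3 <= n)%N -> 0 <= lg n.+1 / n.+1%:R <= lg n / n%:R.
Proof.
move=> n3; have n0 : (0 < n)%N by apply: leq_trans n3.
apply/andP; split; first by apply: divr_ge0 => //; exact: lg_ge0.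
have nr : 0 < n%:R :> R by rewrite ltr0n.
have nr1 : 0 < n.+1%:R :> R by rewrite ltr0n.
have lgn : 1 <= lg n by apply: le_trans lg3_ge1 _; exact: lg_le.
have h := lgS_ub n0.
rewrite ler_pdivrMr // mulrAC ler_pdivlMr // -natr1.
have : (lg n.+1 - lg n) * n%:R <= 1 by rewrite -ler_pdivlMr // mul1r.
rewrite mulrBl mulrDr mulr1; lra.
Qed.

(** These are the partial sums of [- L'(1)]. Abel summation starts at 3, where the weights become
    monotone; the terms at 1 and 2 are estimated directly. *)
Lemma twist_lg_bounded : exists K, forall N,
  normc (twist (fun n => lg n / n%:R) N) <= K.
Proof.
exists (lg 1 / 1 + lg 2 / 2 + 2 * m%:R * (lg 3 / 3)) => N.
have p1 k j : 0 <= lg k / j%:R by apply: divr_ge0 => //; exact: lg_ge0.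
have term k : normc ((lg k / k%:R)%:C * c k) <= lg k / k%:R.
  rewrite normcMr ger0_norm ?p1 // -[leRHS]mulr1.
  by apply: ler_wpM2l => //; exact: p1.
have B0 : 0 <= 2 * m%:R * (lg 3 / 3) by apply: mulr_ge0; [apply: mulr_ge0|exact: p1].
have := term 1%N; have := term 2%N; have := p1 1%N 1%N; have := p1 2%N 2%N.
rewrite /twist; case: N => [|[|N]].
- by rewrite big_geq // normc0; lra.
- by rewrite big_nat1; lra.
rewrite big_ltn // big_ltn // addrA => q1 q2 t1 t2.
apply: le_trans (normcD _ _) _; apply: lerD; last first.
  by apply: twisted_tail => //; exact: lg_div_decreasing.
by apply: le_trans (normcD _ _) _; lra.
Qed.

(** Since [N %/ d >= N / (2 * d)], the error at [d] is at most [2 * K * d / N], and the factor [d]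
    cancels the weight [1 / d]. A bound O(N) for the sum of [|g d|] therefore makes the total error
    O(1). *)
Lemma error_sum_bound (g : nat -> R) (E : nat -> R[i]) K N : (0 < N)%N ->
  0 <= K -> (forall q, (0 < q)%N -> normc (E q) <= K / q%:R) ->
  normc (\sum_(1 <= d < N.+1) (g d / d%:R)%:C * c d * E (N %/ d)%N)
    <= 2 * K / N%:R * \sum_(1 <= d < N.+1) `|g d|.
Proof.
move=> N0 K0 hE; apply: le_trans (normc_sum _ _ _) _.
rewrite mulr_sumr big_seq [leRHS]big_seq; apply: ler_sum => d.
rewrite mem_index_iota ltnS => dN; have /andP[d0 _] := dN.
have q0 : (0 < N %/ d)%N by rewrite divn_gt0 //; case/andP: dN.
rewrite normcM normcMr.
have dr : 0 < d%:R :> R by rewrite ltr0n.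
have h1 : normc (E (N %/ d)%N) <= K * (2 * d%:R / N%:R).
  by apply: le_trans (hE _ q0) _; apply: ler_wpM2l => //; exact: inv_divn_le.
rewrite normrM normfV (ger0_norm (ltW dr)).
apply: le_trans (_ : `|g d| / d%:R * (K * (2 * d%:R / N%:R)) <= _).
  apply: ler_pM => //; try exact: normc_ge0.
    by apply: mulr_ge0; [apply: mulr_ge0 => //; rewrite invr_ge0 ltW|exact: normc_ge0].
  by rewrite -[leRHS]mulr1; apply: ler_wpM2l => //; apply: mulr_ge0 => //; rewrite invr_ge0 ltW.
have nr : N%:R != 0 :> R by rewrite pnatr_eq0 -lt0n.
rewrite le_eqVlt; apply/orP; left; apply/eqP; field.
by rewrite nr gt_eqF.
Qed.

Definition mangoldt_sum N := twist (fun n => mangoldt n / n%:R) N.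

(** The convolution [lg = mangoldt * 1] expresses the bounded sum of [twist_lg_bounded] through the
    partial sums of L(1) up to [N %/ d]. Replacing each of these by [L] costs O(1) by [psi_bound],
    with constant [64 = 2 * 4 * 8] times [m], and leaves [L * mangoldt_sum N]. *)
Lemma mangoldt_sum_L_neq0 (L : R[i]) : L != 0 ->
  (forall N, (0 < N)%N -> normc (L - twist (fun n => n%:R^-1) N) <= 4 * m%:R / N%:R) ->
  exists K, forall N, normc (mangoldt_sum N) <= K.
Proof.
move=> L0 hL; have [K hK] := twist_lg_bounded.
have nL : 0 < normc L.
  by rewrite lt_def normc_ge0 andbT; apply: contraNneq L0 => /eq0_normc ->.
exists ((K + 64 * m%:R) / normc L) => N; rewrite ler_pdivlMr //.
have [->|N0] := posnP N.
  rewrite /mangoldt_sum /twist big_geq // normc0 mul0r.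
  by have := hK 0%N; rewrite /twist big_geq // normc0 => h; apply: addr_ge0 => //; apply: mulr_ge0.
have -> : normc (mangoldt_sum N) * normc L =
  normc (twist (fun n => lg n / n%:R) N +
    \sum_(1 <= d < N.+1) (mangoldt d / d%:R)%:C * c d *
      (L - twist (fun n => n%:R^-1) (N %/ d)%N)).
  rewrite -normcM; congr normc.
  have -> : twist (fun n => lg n / n%:R) N =
     \sum_(1 <= d < N.+1) (mangoldt d / d%:R)%:C * c d * twist (fun n => n%:R^-1) (N %/ d).
    rewrite -twist_convolution; apply: eq_big_nat => n /andP[n0 _].
    congr (_%:C * _); rewrite -sum_mangoldt // mulr_suml.
    rewrite big_seq_cond [RHS]big_seq_cond; apply: eq_bigr => d.
    rewrite mem_index_iota => /andP[/andP[d0 _] dn].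
    by rewrite -{1}(divnK dn) natrM invfM [_^-1 * _]mulrC mulrA.
  rewrite -big_split /= /mangoldt_sum /twist mulr_suml; apply: eq_bigr => d _.
  by rewrite -mulrDr addrC subrK.
apply: le_trans (normcD _ _) _; apply: lerD; first exact: hK.
apply: le_trans (error_sum_bound _ N0 _ hL) _; first by apply: mulr_ge0.
have -> : \sum_(1 <= d < N.+1) `|mangoldt d| = psi N.
  by apply: eq_bigr => d _; rewrite ger0_norm // mangoldt_ge0.
have nr : 0 < N%:R :> R by rewrite ltr0n.
rewrite mulrAC ler_pdivrMr //.
have h : 2 * (4 * m%:R) * psi N <= 2 * (4 * m%:R) * (8 * N%:R) :> R.
  by apply: ler_wpM2l; [apply: mulr_ge0 => //; apply: mulr_ge0 | exact: psi_bound].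
by apply: le_trans h _; lra.
Qed.

(** The sum of [moebius d * (lg N - lg d)] over the divisors of [n] is [mangoldt n], plus [lg N]
    when [n = 1]. Thus the left side is a convolution against partial sums of L(1), all of them pure
    error here. The weight [lg N - lg d] keeps the sum of coefficients below [N] by Stirling. *)
Lemma mangoldt_sum_L_eq0 :
  (forall N, (0 < N)%N -> normc (twist (fun n => n%:R^-1) N) <= 4 * m%:R / N%:R) ->
  c 1 = 1 ->
  forall N, (0 < N)%N -> normc (mangoldt_sum N + (lg N)%:C) <= 8 * m%:R.
Proof.
move=> hL c1 N N0.
have -> : mangoldt_sum N + (lg N)%:C =
  \sum_(1 <= d < N.+1) (moebius d * (lg N - lg d) / d%:R)%:C * c d *
    twist (fun n => n%:R^-1) (N %/ d).
  rewrite -twist_convolution.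
  have -> : (lg N)%:C = \sum_(1 <= n < N.+1) ((n == 1%N)%:R * lg N / n%:R)%:C * c n.
    rewrite big_ltn // eqxx invr1 mulr1 mul1r c1 mulr1 big1_seq ?addr0 // => n /=.
    by rewrite mem_index_iota => /andP[n1 _]; rewrite gtn_eqF // !mul0r.
  rewrite -big_split /=; apply: eq_big_nat => n /andP[n0 _].
  rewrite -mulrDl -rmorphD -mulrDl; congr (_%:C * _).
  rewrite -sum_moebius // -[mangoldt n]opprK -sum_moebius_lg //.
  rewrite addrC mulr_suml -sumrB mulr_suml.
  rewrite big_seq_cond [RHS]big_seq_cond; apply: eq_bigr => d.
  rewrite mem_index_iota => /andP[/andP[d0 _] dn].
  by rewrite -mulrBr -{1}(divnK dn) natrM invfM [_^-1 * _]mulrC mulrA.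
apply: le_trans (error_sum_bound _ N0 _ hL) _; first by apply: mulr_ge0.
have nr : 0 < N%:R :> R by rewrite ltr0n.
rewrite mulrAC ler_pdivrMr //.
have h : \sum_(1 <= d < N.+1) `|moebius d * (lg N - lg d)| <= N%:R.
  apply: le_trans (sum_lg_diff N); rewrite big_seq [leRHS]big_seq; apply: ler_sum => d.
  rewrite mem_index_iota => /andP[d0 dN].
  have l0 : 0 <= lg N - lg d by rewrite subr_ge0 lg_le.
  rewrite normrM (ger0_norm l0) -[leRHS]mul1r.
  by apply: ler_wpM2r => //; exact: moebius_bound.
have := ler_wpM2l (mulr_ge0 (ler0n R 8) (ler0n R m)) h.
lra.
Qed.

End TwistedSums.

(** * Nonvanishing of L(1) for real characters *)

Section RealCharacter.
Variable (r : nat -> R).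
Hypotheses (r1 : r 1 = 1) (rM : forall a b, r (a * b)%N = r a * r b)
  (r3 : forall a, [\/ r a = 0, r a = 1 | r a = -1]).

Definition rdsum n := \sum_(1 <= d < n.+1 | (d %| n)%N) r d.

(** Horner form of [1 + x + ... + x^a], which is the value of [rdsum] at [p ^ a] for a prime [p]
    with [x = r p]. *)
Fixpoint rgeom (x : R) a := if a is b.+1 then x * rgeom x b + 1 else 1.

Lemma rgeom_ge x a : [\/ x = 0, x = 1 | x = -1] ->
  0 <= rgeom x a /\ (~~ odd a -> 1 <= rgeom x a).
Proof.
case=> ->.
- by case: a => [|a] /=; split; rewrite ?mul0r ?add0r.
- suff h : 1 <= rgeom 1 a by split=> //; apply: le_trans h.
  by elim: a => //= a IH; rewrite mul1r; lra.
have -> : rgeom (-1) a = (~~ odd a)%:R.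
  by elim: a => //= a ->; case: (odd a); rewrite /= ?mulr0 ?mulr1 ?add0r ?addNr.
by split=> // ->.
Qed.

Lemma rdsum_pfactor p a n : prime p -> (0 < n)%N -> ~~ (p %| n)%N ->
  rdsum (p ^ a * n) = rgeom (r p) a * rdsum n.
Proof.
move=> pp n0 pn; have p0 := prime_gt0 pp.
elim: a => [|a IH]; first by rewrite expn0 !mul1n mul1r.
have q0 : (0 < p ^ a * n)%N by rewrite muln_gt0 expn_gt0 p0.
rewrite {1}/rdsum expnS -mulnA dsum_prime // big_split /= mulrDl mul1r -mulrA -IH.
congr (_ + _); first by rewrite /rdsum mulr_sumr; apply: eq_bigr => d _; rewrite rM.
rewrite /rdsum -[RHS](@dsum_widen _ _ _ (p ^ a * n)%N); last first.
  by rewrite n0 leq_pmull // expn_gt0 p0.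
rewrite big_mkcond [RHS]big_mkcond /=; apply: eq_bigr => d _.
case: (boolP (p %| d)%N) => pd.
  by rewrite if_same; case: ifP => // dn; case/negP: pn; exact: dvdn_trans dn.
by rewrite Gauss_dvdr // coprimeXr // coprime_sym prime_coprime.
Qed.

Lemma rdsum1 : rdsum 1 = 1.
Proof. by rewrite /rdsum big_mkcond big_nat1. Qed.

Lemma rdsum_ge0 n : (0 < n)%N -> 0 <= rdsum n.
Proof.
elim/ltn_ind: n => n IH n0; have [->|n1] := eqVneq n 1%N; first by rewrite rdsum1.
have n2 : (1 < n)%N by rewrite ltn_neqAle eq_sym n1.
have pp := pdiv_prime n2; have [k cop nE] := pfactor_coprime pp n0.
have pk : ~~ (pdiv n %| k)%N by rewrite -prime_coprime.
have k0 : (0 < k)%N by move: n0; rewrite nE muln_gt0 => /andP[].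
have a0 : (0 < logn (pdiv n) n)%N by rewrite logn_gt0 mem_primes pp n0 pdiv_dvd.
have kn : (k < n)%N by rewrite nE ltn_Pmulr // -(expn0 (pdiv n)) ltn_exp2l // prime_gt1.
rewrite nE mulnC rdsum_pfactor //; apply: mulr_ge0; last exact: IH.
by have [] := rgeom_ge (logn (pdiv n) n) (r3 (pdiv n)).
Qed.

(** Every prime has even exponent in a square, and [rgeom] is at least 1 at even exponents even if
    [r p = -1]. *)
Lemma rdsum_sq k : (0 < k)%N -> 1 <= rdsum (k ^ 2).
Proof.
elim/ltn_ind: k => n IH n0; have [->|n1] := eqVneq n 1%N; first by rewrite rdsum1.
have n2 : (1 < n)%N by rewrite ltn_neqAle eq_sym n1.
have pp := pdiv_prime n2; have [k cop nE] := pfactor_coprime pp n0.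
have pk : ~~ (pdiv n %| k ^ 2)%N by rewrite -prime_coprime // coprimeXr.
have k0 : (0 < k)%N by move: n0; rewrite nE muln_gt0 => /andP[].
have a0 : (0 < logn (pdiv n) n)%N by rewrite logn_gt0 mem_primes pp n0 pdiv_dvd.
have kn : (k < n)%N by rewrite nE ltn_Pmulr // -(expn0 (pdiv n)) ltn_exp2l // prime_gt1.
rewrite nE mulnC expnMn -expnM rdsum_pfactor ?expn_gt0 ?k0 //.
have [_ ] := rgeom_ge (logn (pdiv n) n * 2) (r3 (pdiv n)).
rewrite oddM andbF => /(_ isT) h; rewrite -[leLHS]mul1r.
by apply: ler_pM => //; exact: IH.
Qed.

Lemma rdsum_sum_lb k : k%:R <= \sum_(1 <= n < (k ^ 2).+1) rdsum n.
Proof.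
elim: k => [|k IH]; first by rewrite big_geq.
rewrite (big_cat_nat (n := (k ^ 2).+1)) //=; last by rewrite ltnS leq_exp2r.
rewrite -natr1; apply: lerD => //.
rewrite big_nat_recr /=; last by rewrite ltn_exp2r.
rewrite -[leLHS]add0r; apply: lerD; last exact: rdsum_sq.
rewrite big_seq; apply: sumr_ge0 => n; rewrite mem_index_iota => /andP[h _].
by apply: rdsum_ge0; apply: leq_trans h.
Qed.

End RealCharacter.

(** * Monotone weights for the truncated Lambert series *)

Lemma geom_sum (t : R) n : (1 - t) * (\sum_(0 <= i < n) t ^+ i) = 1 - t ^+ n.
Proof.
elim: n => [|n IH]; first by rewrite big_geq // mulr0 expr0 subrr.
by rewrite big_nat_recr //= mulrDr IH exprS; ring.
Qed.

(* AM-GM on the terms of exponent 2i and 2(n-i). *)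
Lemma geom_sq_lb (s : R) n : n.+1%:R * s ^+ n <= \sum_(0 <= i < n.+1) (s ^+ 2) ^+ i.
Proof.
rewrite big_mkord.
have : \sum_(i < n.+1) (s ^+ 2) ^+ i + \sum_(i < n.+1) (s ^+ 2) ^+ i >=
   \sum_(i < n.+1) (s ^+ n + s ^+ n).
  rewrite [X in _ <= _ + X](reindex_inj rev_ord_inj) -big_split /=.
  apply: ler_sum => i _; have iE : n = (i + (n - i))%N by rewrite subnKC // -ltnS.
  rewrite subSS {1 2}iE exprD -!exprM ![(2 * _)%N]mulnC !exprM -subr_ge0.
  have -> : (s ^+ i) ^+ 2 + (s ^+ (n - i)) ^+ 2 -
    (s ^+ i * s ^+ (n - i) + s ^+ i * s ^+ (n - i)) = (s ^+ i - s ^+ (n - i)) ^+ 2 by ring.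
  exact: sqr_ge0.
by rewrite sumr_const card_ord -mulr_natl; lra.
Qed.

Section LambertDecreasing.
Variable s : R.
Hypotheses (s0 : 0 < s) (s1 : s < 1).
Let t := s ^+ 2.

(** As [t] tends to 1 the singular parts of the two terms cancel. Writing [t] as a square makes its
    half-integer powers available as powers of [s], as the AM-GM bound requires. *)
Definition lambert_gap n : R := (1 - t)^-1 / n%:R - t ^+ n / (1 - t ^+ n).

Let t0 : 0 < t. Proof. exact: exprn_gt0. Qed.
Let t1 : t < 1. Proof. by rewrite expr_lt1 // ltW. Qed.

Let G n := \sum_(0 <= i < n) t ^+ i.

Let G_gt0 n : 0 < G n.+1.
Proof.
rewrite /G big_nat_recl // expr0; apply: ltr_pwDl => //.
by apply: sumr_ge0 => i _; apply: exprn_ge0; exact: ltW.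
Qed.

Lemma lambert_gapE n : lambert_gap n.+1 = (1 - t)^-1 * (n.+1%:R^-1 - t ^+ n.+1 / G n.+1).
Proof.
rewrite /lambert_gap -geom_sum -/(G _) mulrBr; congr (_ - _).
by rewrite invfM mulrCA.
Qed.

(** This first weight does not depend on [t], which makes the Abel bound uniform in [t]. *)
Lemma lambert_gap1 : lambert_gap 1 = 1.
Proof.
rewrite lambert_gapE /G big_nat1 expr0 expr1 !divr1 invr1 mulVf //.
by rewrite gt_eqF // subr_gt0.
Qed.

Lemma lambert_gap_decreasing n : (1 <= n)%N ->
  0 <= lambert_gap n.+1 <= lambert_gap n.
Proof.
case: n => // n _; rewrite !lambert_gapE.
have i0 : 0 < (1 - t)^-1 by rewrite invr_gt0 subr_gt0.
have g1 := G_gt0 n; have g2 := G_gt0 n.+1.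
have lb1 : n.+1%:R * s ^+ n <= G n.+1 := geom_sq_lb s n.
have lb2 : n.+2%:R * s ^+ n.+1 <= G n.+2 := geom_sq_lb s n.+1.
have x0 : 0 < n.+1%:R :> R by rewrite ltr0n.
have y0 : 0 < n.+2%:R :> R by rewrite ltr0n.
have sp k : 0 < s ^+ k by exact: exprn_gt0.
have tE k : t ^+ k = s ^+ k * s ^+ k by rewrite /t -exprM mulnC exprM expr2.
have s_le k : s ^+ k <= 1 by apply: exprn_ile1; exact: ltW.
apply/andP; split.
  apply: mulr_ge0; first exact: ltW.
  rewrite subr_ge0 ler_pdivrMr // -ler_pdivrMl ?invr_gt0 // invrK.
  apply: le_trans lb2; apply: ler_wpM2l; first exact: ltW.
  rewrite tE -[leRHS]mul1r; apply: ler_pM => //; try exact: ltW.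
  by rewrite exprS -[leRHS]mul1r; apply: ler_wpM2r; exact: ltW.
apply: ler_wpM2l; first exact: ltW.
have gE : G n.+2 = t * G n.+1 + 1.
  by rewrite /G big_nat_recl // expr0 addrC mulr_sumr; congr (_ + _); apply: eq_bigr => i _; rewrite exprS.
(* Over a common denominator, monotonicity is exactly this inequality. The two AM-GM bounds multiply
   to the power [s ^ (2n+1)], which exceeds [t ^ (n+1) = s ^ (2n+2)]. *)
have main : n.+1%:R * n.+2%:R * t ^+ n.+1 <= G n.+1 * G n.+2.
  apply: le_trans (_ : (n.+1%:R * s ^+ n) * (n.+2%:R * s ^+ n.+1) <= _).
    rewrite mulrACA; apply: ler_wpM2l; first by apply: mulr_ge0; exact: ltW.
    rewrite tE; apply: ler_wpM2r; first exact: ltW.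
    by rewrite exprS -[leRHS]mul1r; apply: ler_wpM2r; exact: ltW.
  by apply: ler_pM => //; apply: mulr_ge0; exact: ltW.
rewrite -subr_ge0.
have -> : n.+1%:R^-1 - t ^+ n.+1 / G n.+1 - (n.+2%:R^-1 - t ^+ n.+2 / G n.+2) =
   (G n.+1 * G n.+2 - n.+1%:R * n.+2%:R * t ^+ n.+1) / (n.+1%:R * n.+2%:R * (G n.+1 * G n.+2)).
  have e1 : n.+2%:R - n.+1%:R = 1 :> R by rewrite -natrB // subSnn.
  have e2 : G n.+2 - t * G n.+1 = 1 by rewrite gE; ring.
  have -> : n.+1%:R^-1 - t ^+ n.+1 / G n.+1 - (n.+2%:R^-1 - t ^+ n.+2 / G n.+2) =
    ((n.+2%:R - n.+1%:R) * (G n.+1 * G n.+2) -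
      n.+1%:R * n.+2%:R * t ^+ n.+1 * (G n.+2 - t * G n.+1)) / (n.+1%:R * n.+2%:R * (G n.+1 * G n.+2)).
    rewrite [t ^+ n.+2]exprS.
    move: (gt_eqF x0) (gt_eqF y0) (gt_eqF g1) (gt_eqF g2).
    move: (n.+1%:R : R) (n.+2%:R : R) (G n.+1) (G n.+2) (t ^+ n.+1) => x y g h u.
    by move=> ex ey eg eh; field; rewrite ex ey eg eh.
  by rewrite e1 e2 mul1r mulr1.
apply: divr_ge0; first by rewrite subr_ge0.
by apply: mulr_ge0; apply: mulr_ge0; exact: ltW.
Qed.

End LambertDecreasing.

Lemma geom_sum_from (x : R) Q : x != 1 ->
  \sum_(1 <= q < Q.+1) x ^+ q = (x - x ^+ Q.+1) / (1 - x).
Proof.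
move=> x1; have d0 : 1 - x != 0 by rewrite subr_eq0 eq_sym.
apply: (mulIf d0); rewrite divfK // mulrC.
have := geom_sum x Q.+1; rewrite big_ltn // expr0 mulrDr mulr1.
by set w := (1 - x) * _; lra.
Qed.

Section RealNonvanishing.
Variables (m : nat) (r : nat -> R) (C : R).
Hypotheses (m0 : (0 < m)%N) (r1 : r 1 = 1)
  (rM : forall a b, r (a * b)%N = r a * r b)
  (r3 : forall a, [\/ r a = 0, r a = 1 | r a = -1])
  (rmod : forall a, r (a %% m)%N = r a)
  (rsum : \sum_(0 <= a < m) r a = 0)
  (C0 : 0 <= C)
  (hL : forall N, (0 < N)%N -> `|\sum_(1 <= n < N.+1) r n / n%:R| <= C / N%:R).

Let r_le1 a : `|r a| <= 1.
Proof. by case: (r3 a) => ->; rewrite ?normrN ?normr0 ?normr1. Qed.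

Lemma sum_gap_bounded s K : 0 < s < 1 ->
  `|\sum_(1 <= n < K.+1) lambert_gap s n * r n| <= 2 * m%:R.
Proof.
move=> /andP[s0 s1]; rewrite -normc_real rmorph_sum /=.
under eq_bigr do rewrite rmorphM.
have := @twisted_tail m (fun n => (r n)%:C) m0 _ _ _ (lambert_gap s) 1 K.+1.
rewrite lambert_gap1 // mulr1; apply => //.
- by move=> a; rewrite rmod.
- by move=> a; rewrite normc_real; exact: r_le1.
- by rewrite -rmorph_sum rsum.
- exact: lambert_gap_decreasing.
Qed.

(** Truncating at [K] leaves for each [d] a geometric sum up to [q = K %/ d]. The missing tail
    starts at exponent [d * (K %/ d + 1) > K], so it is at most [t^K / (1 - t)], and there are [K]
    values of [d]. *)
Lemma lambert_sum (t : R) K : 0 < t < 1 ->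
  `|\sum_(1 <= n < K.+1) rdsum r n * t ^+ n -
    \sum_(1 <= d < K.+1) r d * (t ^+ d / (1 - t ^+ d))| <= K%:R * t ^+ K / (1 - t).
Proof.
move=> /andP[t0 t1].
have -> : \sum_(1 <= n < K.+1) rdsum r n * t ^+ n =
    \sum_(1 <= d < K.+1) r d * \sum_(1 <= q < (K %/ d).+1) (t ^+ d) ^+ q.
  transitivity (\sum_(1 <= n < K.+1) \sum_(1 <= d < n.+1 | (d %| n)%N)
      (fun d q : nat => r d * (t ^+ d) ^+ q) d (n %/ d)%N).
    apply: eq_bigr => n _; rewrite mulr_suml; apply: eq_bigr => d dn /=.
    by rewrite -exprM mulnC divnK.
  rewrite (dirichlet_sum (fun d q : nat => r d * (t ^+ d) ^+ q)).
  by apply: eq_bigr => d _; rewrite mulr_sumr.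
rewrite -sumrB; apply: le_trans (ler_norm_sum _ _ _) _.
have -> : K%:R * t ^+ K / (1 - t) = \sum_(1 <= d < K.+1) t ^+ K / (1 - t).
  by rewrite sumr_const_nat subn1 /= -mulrA mulr_natl.
rewrite big_seq [leRHS]big_seq; apply: ler_sum => d.
rewrite mem_index_iota => /andP[d0 dK].
have td : t ^+ d <= t by rewrite -[leRHS]expr1; apply: ler_wiXn2l => //; exact: ltW.
have td1 : 0 < 1 - t ^+ d by lra.
have t1' : 0 < 1 - t by lra.
rewrite -mulrBr normrM -[leRHS]mul1r; apply: ler_pM => //.
rewrite geom_sum_from; last by apply/eqP => h; lra.
rewrite -mulrBl addrAC subrr add0r mulNr normrN -exprM.
rewrite ger0_norm; last by apply: divr_ge0; [apply: exprn_ge0|]; exact: ltW.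
apply: ler_pM; [apply: exprn_ge0; exact: ltW | by rewrite invr_ge0 ltW | |].
  apply: ler_wiXn2l; [exact: ltW | exact: ltW |].
  by rewrite ltnW // mulnC ltn_ceil.
by rewrite lef_pV2 ?posrE //; lra.
Qed.

Lemma rdsum_abel_bound s K : 0 < s < 1 -> (0 < K)%N ->
  \sum_(1 <= n < K.+1) rdsum r n * (s ^+ 2) ^+ n <=
   2 * m%:R + (C / K%:R + K%:R * (s ^+ 2) ^+ K) / (1 - s ^+ 2).
Proof.
move=> hs K0; have /andP[s0 s1] := hs.
have ht : 0 < s ^+ 2 < 1 by rewrite exprn_gt0 // expr_lt1 // ltW.
have := lambert_sum K ht; have := sum_gap_bounded K hs; have := hL K0.
set t := s ^+ 2; set A := \sum_(_ <= _ < _) _ / _; set B := \sum_(_ <= _ < _) _ * _.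
set D := \sum_(_ <= n < _) rdsum r n * _; set E := \sum_(_ <= _ < _) _ => hA hB hD.
(* The Lambert sum is the partial sum of L(1) over [1 - t], of size O(1/K) by [hL], minus the gap
   sum, bounded by [2 * m] uniformly in [s]. *)
have dE : E = A / (1 - t) - B.
  rewrite /E /A /B mulr_suml -sumrB; apply: eq_bigr => d _.
  by rewrite /lambert_gap -/t; ring.
have t1 : 0 < (1 - t)^-1 by have /andP[_ ?] := ht; rewrite invr_gt0 subr_gt0.
have hA' : A / (1 - t) <= C / K%:R / (1 - t).
  by rewrite ler_pM2r //; apply: le_trans (ler_norm _) hA.
move: hB hD; rewrite !ler_norml dE mulrDl => /andP[b1 b2] /andP[d1 d2]; lra.
Qed.

(** Each of the [K] terms [s^i] with [i < K] is at least [s^K]. *)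
Lemma natr_exp_bound (s : R) K : 0 < s < 1 -> K%:R * s ^+ K <= (1 - s)^-1.
Proof.
move=> /andP[s0 s1]; have d0 : 0 < 1 - s by rewrite subr_gt0.
rewrite -[leRHS]mul1r ler_pdivlMr // mulrC.
apply: le_trans (_ : (1 - s) * (\sum_(0 <= i < K) s ^+ i) <= _); last first.
  by rewrite geom_sum gerBl; apply: exprn_ge0; exact: ltW.
apply: ler_wpM2l; first exact: ltW.
have -> : K%:R * s ^+ K = \sum_(0 <= i < K) s ^+ K by rewrite sumr_const_nat subn0 mulr_natl.
rewrite big_seq [leRHS]big_seq; apply: ler_sum => i.
by rewrite mem_index_iota => /andP[_ iK]; apply: ler_wiXn2l; [exact: ltW|exact: ltW|exact: ltnW].
Qed.

Lemma bernoulli_le (u : R) n : 0 <= u <= 1 -> 1 - n%:R * u <= (1 - u) ^+ n.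
Proof.
move=> /andP[u0 u1]; elim: n => [|n IH]; first by rewrite mul0r subr0 expr0.
rewrite exprS; apply: le_trans (_ : (1 - u) * (1 - n%:R * u) <= _); last first.
  by apply: ler_wpM2l => //; lra.
have : 0 <= n%:R * (u * u) by apply: mulr_ge0 => //; apply: mulr_ge0.
by rewrite -natr1; nra.
Qed.

Lemma real_nonvanishing : False.
Proof.
(* The squares up to [M] make the coefficients sum to at least [k]. With [u = 1 / (4 * M)],
   Bernoulli gives [t ^ M = (1 - u) ^ (2 * M) >= 1/2], so the power series is at least
   [k / 2 = 2 * m + 5/2]. The upper bound will be [2 * m + 1]. *)
pose k := (4 * m + 5)%N; pose M := (k ^ 2)%N.
have M0 : (0 < M)%N by rewrite expn_gt0 /k addn_gt0 orbT.
have Mr : 0 < M%:R :> R by rewrite ltr0n.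
pose u : R := (4 * M%:R)^-1.
have u0 : 0 < u by rewrite invr_gt0; apply: mulr_gt0.
have u4 : 4 * M%:R * u = 1 by rewrite divff // gt_eqF //; apply: mulr_gt0.
have M1 : 1 <= M%:R :> R by rewrite ler1n.
have u1 : u <= 4^-1 by rewrite /u lef_pV2 ?posrE //; lra.
pose s := 1 - u; have hs : 0 < s < 1 by rewrite /s; apply/andP; split; lra.
have /andP[s0 s1] := hs.
have tM : 2^-1 <= (s ^+ 2) ^+ M.
  rewrite -exprM; apply: le_trans (bernoulli_le _ _); last by apply/andP; split; lra.
  by rewrite natrM; lra.
have t1 : 0 < 1 - s ^+ 2 by rewrite subr_gt0 expr_lt1 // ltW.
(* With [s] now fixed, [X / K] dominates both error terms: [natr_exp_bound], used twice, turns
   [K * t^K] into O(1/K). Hence [K >= X] makes the error at most 1, while [K >= M] keeps the squares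
   in range. *)
pose X := (C + (1 - s)^-1 * (1 - s)^-1) / (1 - s ^+ 2).
have i0 : 0 < (1 - s)^-1 by rewrite invr_gt0 subr_gt0.
have X0 : 0 <= X by apply: divr_ge0; [apply: addr_ge0 => //; apply: mulr_ge0|]; exact: ltW.
have [K MK XK] : exists2 K, (M <= K)%N & X <= K%:R.
  exists (maxn M (Num.bound X)); first exact: leq_maxl.
  apply: ltW; apply: lt_le_trans (_ : (Num.bound X)%:R <= _).
    exact: archi_boundP.
  by rewrite ler_nat leq_maxr.
have K0 : (0 < K)%N := leq_trans M0 MK.
have Kr : 0 < K%:R :> R by rewrite ltr0n.
have := rdsum_abel_bound hs K0.
have eb := natr_exp_bound K hs.
have e2 : K%:R * (s ^+ 2) ^+ K <= (1 - s)^-1 * (1 - s)^-1 / K%:R.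
  rewrite ler_pdivlMr // exprAC expr2.
  have -> : K%:R * (s ^+ K * s ^+ K) * K%:R = (K%:R * s ^+ K) * (K%:R * s ^+ K) by ring.
  have k0 : 0 <= K%:R * s ^+ K by apply: mulr_ge0 => //; apply: exprn_ge0; exact: ltW.
  exact: ler_pM.
have e3 : (C / K%:R + K%:R * (s ^+ 2) ^+ K) / (1 - s ^+ 2) <= 1.
  apply: le_trans (_ : (C / K%:R + (1 - s)^-1 * (1 - s)^-1 / K%:R) / (1 - s ^+ 2) <= _).
    by rewrite ler_pM2r ?invr_gt0 // lerD2l.
  by rewrite -mulrDl mulrAC ler_pdivrMr // mul1r.
have lb := rdsum_sum_lb r1 rM r3 k.
have pos n : (0 < n)%N -> 0 <= rdsum r n * (s ^+ 2) ^+ n.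
  by move=> n0; apply: mulr_ge0; [exact: rdsum_ge0 | do 2 apply: exprn_ge0; exact: ltW].
have e4 : 2^-1 * k%:R <= \sum_(1 <= n < K.+1) rdsum r n * (s ^+ 2) ^+ n.
  rewrite (big_cat_nat (n := M.+1)) //= -[leLHS]addr0; apply: lerD; last first.
    rewrite big_seq; apply: sumr_ge0 => n; rewrite mem_index_iota => /andP[h _].
    by apply: pos; apply: leq_trans h.
  apply: le_trans (_ : 2^-1 * \sum_(1 <= n < M.+1) rdsum r n <= _).
    by apply: ler_wpM2l => //; rewrite invr_ge0.
  rewrite mulr_sumr big_seq [leRHS]big_seq; apply: ler_sum => n.
  rewrite mem_index_iota => /andP[n0 nM]; rewrite mulrC; apply: ler_wpM2l; first exact: rdsum_ge0.
  apply: le_trans tM _; apply: ler_wiXn2l; [apply: exprn_ge0 | | by []]; first exact: ltW.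
  by apply: ltW; rewrite -subr_gt0.
have kE : k%:R = 4 * m%:R + 5 :> R by rewrite natrD natrM.
rewrite kE in e4; set S := \sum_(_ <= _ < _) _ in e4 *; lra.
Qed.

End RealNonvanishing.

(** * Mertens theorems in a residue class *)

Section MertensClass.
Variables (m : nat) (G : dirichlet_characters m).
Hypothesis m0 : (0 < m)%N.
Implicit Types x : G.

Lemma chi_le1 x a : normc (chi x a) <= 1.
Proof. by rewrite chi_norm; case: coprime. Qed.

Lemma chi1 x : chi x 1 = 1.
Proof.
have n1 : chi x 1 != 0.
  apply/eqP => h; have := chi_norm x 1; rewrite h normc0 coprime1n => /eqP.
  by rewrite eq_sym oner_eq0.
by apply: (mulfI n1); rewrite -chiM mulr1.
Qed.

(** The statement L(1,chi) = 0, put as the convergence rate that [L_exists] provides and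
    [mangoldt_sum_L_eq0] consumes. *)
Definition vanishing x := forall N, (0 < N)%N ->
  normc (twist (chi x) (fun n => n%:R^-1) N) <= 4 * m%:R / N%:R.

Lemma mangoldt_sum_dichotomy x : x != dchar0 G ->
  vanishing x \/ exists K, forall N, normc (mangoldt_sum (chi x) N) <= K.
Proof.
move=> x0.
have [L hL] := L_exists m0 (chi_mod x) (chi_le1 x) (chi_sum x0).
have [L0|L0] := eqVneq L 0.
  by left => N N0; have := hL N N0; rewrite L0 sub0r normcN.
right; exact: (mangoldt_sum_L_neq0 m0 (chiM x) (chi_mod x) (chi_le1 x) (chi_sum x0) L0 hL).
Qed.

Lemma mangoldt_sum_vanishing x : x != dchar0 G -> vanishing x ->
  forall N, (0 < N)%N -> normc (mangoldt_sum (chi x) N + (lg N)%:C) <= 8 * m%:R.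
Proof.
move=> x0 vx N N0.
exact: (mangoldt_sum_L_eq0 (chiM x) (chi_le1 x) vx (chi1 x)).
Qed.

(** The principal character only drops the [d] not prime to [m]: proper prime powers, with total at
    most 4, and primes dividing [m], all at most [m]. *)
Lemma mangoldt_sum_principal : exists K, forall N, (0 < N)%N ->
  normc (mangoldt_sum (chi (dchar0 G)) N - (lg N)%:C) <= K.
Proof.
exists (8 + (4 + \sum_(1 <= d < m.+1) lg d / d%:R)) => N N0.
have -> : mangoldt_sum (chi (dchar0 G)) N =
    (\sum_(1 <= d < N.+1 | coprime d m) mangoldt d / d%:R)%:C.
  rewrite /mangoldt_sum /twist [in RHS]big_mkcond rmorph_sum; apply: eq_bigr => d _ /=.
  by rewrite chi_principal; case: coprime; rewrite ?mulr1 // mulr0 rmorph0.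
rewrite -rmorphB normc_real.
have h := sum_mangoldt_div N0; move: h.
rewrite (bigID (fun d => coprime d m)) /=; set A := \sum_(_ <= _ < _ | _) _.
set B := \sum_(_ <= _ < _ | _) _.
have T0 d : 0 <= mangoldt d / d%:R by apply: divr_ge0 => //; exact: mangoldt_ge0.
have B0 : 0 <= B by apply: sumr_ge0 => d _.
suff B1 : B <= 4 + \sum_(1 <= d < m.+1) lg d / d%:R.
  by rewrite !ler_norml => /andP[h1 h2]; apply/andP; split; lra.
rewrite /B (bigID (fun d => ~~ prime d)) /=; apply: lerD.
  apply: le_trans (sum_mangoldt_nonprime N); rewrite big_mkcond [leRHS]big_mkcond.
  by apply: ler_sum => d _; case: (prime d); rewrite ?andbF //= ?andbT; case: ifP.
apply: le_trans (_ : \sum_(1 <= d < N.+1 | (d <= m)%N) lg d / d%:R <= _).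
  rewrite big_mkcond [leRHS]big_mkcond; apply: ler_sum => d _.
  have L0 : 0 <= lg d / d%:R by apply: divr_ge0 => //; exact: lg_ge0.
  rewrite negbK; case: (boolP (prime d)) => pd; last by rewrite andbF; case: ifP.
  rewrite prime_coprime // negbK andbT; case: (boolP (d %| m)%N) => dm; last by case: ifP.
  by rewrite dvdn_leq // mangoldt_prime.
have L0 d : 0 <= lg d / d%:R by apply: divr_ge0 => //; exact: lg_ge0.
have [Nm|mN] := leqP N m.
  rewrite [leRHS](big_cat_nat (n := N.+1)) //= -[leLHS]addr0; apply: lerD; last exact: sumr_ge0.
  by rewrite big_mkcond; apply: ler_sum => d _; case: ifP.
rewrite (big_cat_nat (n := m.+1)) //=; last by rewrite ltnS ltnW.
rewrite -[leRHS]addr0; apply: lerD.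
  by rewrite big_mkcond; apply: ler_sum => d _; case: ifP.
by rewrite big1_seq // => d; rewrite mem_index_iota ltnNge => /andP[-> ].
Qed.

Lemma sum_mangoldt_sum N (f : G -> R[i]) :
  \sum_x f x * mangoldt_sum (chi x) N =
  \sum_(1 <= d < N.+1) (mangoldt d / d%:R)%:C * \sum_x f x * chi x d.
Proof.
rewrite /mangoldt_sum /twist; under eq_bigr do rewrite mulr_sumr.
rewrite exchange_big /=; apply: eq_bigr => d _; rewrite mulr_sumr.
by apply: eq_bigr => x _; rewrite mulrCA.
Qed.

(** By orthogonality the sum is [totient m] times the sum of [mangoldt d / d] over [d = 1] mod
    [m]. *)
Lemma Re_mangoldt_sum_ge0 N : 0 <= complex.Re (\sum_(x : G) mangoldt_sum (chi x) N).
Proof.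
under eq_bigr do rewrite -[mangoldt_sum _ _]mul1r.
rewrite sum_mangoldt_sum raddf_sum; apply: sumr_ge0 => d _ /=.
under eq_bigr do rewrite mul1r.
have [cd|ncd] := boolP (coprime d m).
  rewrite chi_dual // -[((_ * _)%N)%:R](rmorph_nat (real_complex R)) -rmorphM /=.
  by apply: mulr_ge0 => //; apply: divr_ge0 => //; exact: mangoldt_ge0.
rewrite big1 ?mulr0 // => x _; apply: eq0_normc.
by rewrite chi_norm (negPf ncd).
Qed.

Lemma lg_unbounded (K : R) : exists N, (0 < N)%N /\ K < lg N.
Proof.
pose e := Rtrigo_def.exp K; have /RltP e0 := Exp_prop.exp_pos K.
exists (Num.bound e); have h : e < (Num.bound e)%:R by apply: archi_boundP; exact: ltW.
split; first by rewrite -(ltr0n R); exact: lt_trans h.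
apply/RltP; rewrite -[K]Rpower.ln_exp; apply: Rpower.ln_increasing; exact/RltP.
Qed.

Lemma mangoldt_sum_upper x : x != dchar0 G -> exists K, forall N, (0 < N)%N ->
  complex.Re (mangoldt_sum (chi x) N) <= K.
Proof.
move=> x0; have [vx|[K hK]] := mangoldt_sum_dichotomy x0; last first.
  by exists K => N _; apply: le_trans (hK N); apply: le_trans (ler_norm _) (normc_geRe _).
exists (8 * m%:R) => N N0; have := mangoldt_sum_vanishing x0 vx N0.
have := normc_geRe (mangoldt_sum (chi x) N + (lg N)%:C); rewrite raddfD /=.
have := lg_ge0 N; rewrite ler_norml => l0 /andP[h1 h2] h3.
by move: (le_trans h2 h3); lra.
Qed.

(* Two characters with L(1) = 0 would make the sum of mangoldt n / n over
   n = 1 mod m tend to -oo. *)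
Lemma vanishing_unique x y : x != dchar0 G -> y != dchar0 G ->
  vanishing x -> vanishing y -> x = y.
Proof.
move=> x0 y0 vx vy; apply/eqP; apply/negPn/negP => xy.
have [K0 hK0] := mangoldt_sum_principal.
have /fin_all_exists[K hK] : forall z : G, exists K, z != dchar0 G -> forall N, (0 < N)%N ->
    complex.Re (mangoldt_sum (chi z) N) <= K.
  move=> z; have [->|z0] := eqVneq z (dchar0 G); first by exists 0.
  by have [K hK] := mangoldt_sum_upper z0; exists K => _.
pose S := \sum_(z : G | (z != dchar0 G) && (z != x) && (z != y)) K z.
have [N [N0 hN]] := lg_unbounded (K0 + 8 * m%:R + 8 * m%:R + S).
have := Re_mangoldt_sum_ge0 N.
rewrite raddf_sum (bigD1 (dchar0 G)) //= (bigD1 x) //= (bigD1 y) /=; last first.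
  by rewrite y0 eq_sym.
have hS : \sum_(z : G | (z != dchar0 G) && (z != x) && (z != y))
   complex.Re (mangoldt_sum (chi z) N) <= S.
  by apply: ler_sum => z /andP[/andP[z0 _] _]; exact: hK.
have Reb (z w : R[i]) B : normc (z - w) <= B -> complex.Re z <= complex.Re w + B.
  move=> h; have := le_trans (le_trans (ler_norm _) (normc_geRe _)) h.
  by rewrite raddfB /=; lra.
have ReDb (z : R[i]) (w B : R) : normc (z + w%:C) <= B -> complex.Re z + w <= B.
  move=> h; have := le_trans (le_trans (ler_norm _) (normc_geRe _)) h.
  by rewrite raddfD /=; lra.
have /Reb := hK0 N N0; have /ReDb := mangoldt_sum_vanishing x0 vx N0.
have /ReDb := mangoldt_sum_vanishing y0 vy N0.
rewrite /=; set a := \sum_(_ | _) _ in hS *; lra.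
Qed.

(** The record does not state that a character is determined by its values, so the contradiction
    comes from the sum over a period, which would be both 0 and [totient m]. *)
Lemma dchar0N x : x != dchar0 G -> dcharN x != dchar0 G.
Proof.
apply: contra_neq => e; apply/eqP/negPn/negP => x0.
have := chi_sum x0.
have -> : \sum_(0 <= a < m) chi x a = (totient m)%:R.
  rewrite totient_count_coprime natr_sum; apply: eq_bigr => a _.
  rewrite -[chi x a]conjcK -chiN e chi_principal conjc_nat.
  by rewrite coprime_sym.
by move/eqP; rewrite pnatr_eq0 -leqn0 leqNgt totient_gt0 m0.
Qed.

Lemma vanishingN x : vanishing x -> vanishing (dcharN x).
Proof.
move=> vx N N0; have := vx N N0.
have -> : twist (chi (dcharN x)) (fun n => n%:R^-1) N =
   (twist (chi x) (fun n => n%:R^-1) N)^*.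
  rewrite /twist rmorph_sum; apply: eq_bigr => n _.
  by rewrite rmorphM chiN; congr (_ * _); exact/esym/conjc_real.
by case: (twist _ _ _) => a b /=; rewrite sqrrN.
Qed.

Lemma chi_real x : dcharN x = x -> forall a, chi x a = (complex.Re (chi x a))%:C.
Proof.
move=> xx a; have := chiN x a; rewrite xx; case: (chi x a) => u v [] /= h.
by congr (_ +i* _); lra.
Qed.

Lemma nonvanishing x : x != dchar0 G -> ~ vanishing x.
Proof.
move=> x0 vx.
have xx : dcharN x = x := vanishing_unique (dchar0N x0) x0 (vanishingN vx) vx.
have cR := chi_real xx; pose r a := complex.Re (chi x a).
apply: (@real_nonvanishing m r (4 * m%:R) m0).
- by rewrite /r chi1.
- by move=> a b; rewrite /r chiM cR (cR b) /=; ring.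
- move=> a; have := chi_norm x a; rewrite cR normc_real -/(r a).
  case: coprime => /=; last by move/eqP; rewrite normr_eq0 => /eqP ->; constructor 1.
  by case: (ger0P (r a)) => _ h; [constructor 2|constructor 3]; lra.
- by move=> a; rewrite /r chi_mod.
- by rewrite /r -raddf_sum chi_sum.
- exact: mulr_ge0.
move=> N N0; have := vx N N0; rewrite -normc_real rmorph_sum.
by congr (normc _ <= _); apply: eq_bigr => n _; rewrite mulrC rmorphM /= -cR.
Qed.

Lemma mangoldt_sum_bounded x : x != dchar0 G ->
  exists K, forall N, normc (mangoldt_sum (chi x) N) <= K.
Proof. by move=> x0; have [/(nonvanishing x0)|] := mangoldt_sum_dichotomy x0. Qed.

Lemma mertens_mangoldt n : (0 < n)%N -> coprime n m -> exists K, forall N, (0 < N)%N ->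
  `|\sum_(1 <= d < N.+1 | d == n %[mod m]) mangoldt d / d%:R - lg N / (totient m)%:R| <= K.
Proof.
move=> n0 cnm.
(* Weighting by [chi x b], with [b] inverse to [n], plays the part of the conjugate of [chi x n]:
   orthogonality at [b * d] selects [d = n] mod [m]. *)
have [b hb] : exists b, b * n = 1 %[mod m].
  case: (egcdnP m n0) => b k e _; exists b.
  by move: cnm; rewrite /coprime => /eqP g1; rewrite e g1 modnMDl.
have cb : coprime b m.
  have : coprime (b * n) m by rewrite -coprime_modl hb coprime_modl coprime1n.
  by rewrite coprimeMl => /andP[].
have [K0 hK0] := mangoldt_sum_principal.
have /fin_all_exists[K hK] : forall z : G, exists K, z != dchar0 G -> forall N,
    normc (mangoldt_sum (chi z) N) <= K.
  move=> z; have [->|z0] := eqVneq z (dchar0 G); first by exists 0.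
  by have [K hK] := mangoldt_sum_bounded z0; exists K => _.
have phi0 : 0 < (totient m)%:R :> R by rewrite ltr0n totient_gt0.
exists ((K0 + \sum_(z : G | z != dchar0 G) K z) / (totient m)%:R) => N N0.
rewrite ler_pdivlMr // -[X in _ * X](ger0_norm (ltW phi0)) -normrM mulrBl divfK ?gt_eqF //.
rewrite -normc_real rmorphB rmorphM.
have -> : (\sum_(1 <= d < N.+1 | d == n %[mod m]) mangoldt d / d%:R)%:C *
    ((totient m)%:R)%:C = \sum_(x : G) chi x b * mangoldt_sum (chi x) N.
  rewrite sum_mangoldt_sum big_mkcond rmorph_sum mulr_suml; apply: eq_bigr => d _ /=.
  under [in RHS]eq_bigr do rewrite -chiM.
  have [cd|ncd] := boolP (coprime d m); last first.
    rewrite [in RHS]big1 => [|x _]; last first.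
      by apply: eq0_normc; rewrite chi_norm coprimeMl (negPf ncd) andbF.
    rewrite mulr0; case: eqP => [e|_]; last by rewrite mul0r.
    by move: ncd; rewrite -coprime_modl e coprime_modl cnm.
  rewrite chi_dual ?coprimeMl ?cb // rmorph_nat.
  have -> : (b * d == 1 %[mod m]) = (d == n %[mod m]).
    apply/eqP/eqP => e.
      rewrite -[d]mul1n -modnMml -hb modnMml mulnAC -modnMml e modnMml mul1n //.
    by rewrite -modnMmr e modnMmr hb.
  by case: eqP => _; rewrite ?mul1n ?mul0n ?mulr0 ?mul0r.
rewrite (bigD1 (dchar0 G)) //= chi_principal cb mul1r addrAC.
apply: le_trans (normcD _ _) _; apply: lerD; first exact: hK0.
apply: le_trans (normc_sum _ _ _) _; apply: ler_sum => x x0.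
rewrite normcM -[leRHS]mul1r; apply: ler_pM => //; try exact: normc_ge0.
  exact: chi_le1.
exact: hK.
Qed.

End MertensClass.

Lemma mertens_class m n : (0 < m)%N -> (0 < n)%N -> coprime n m ->
  exists K, forall N, (0 < N)%N ->
  `|\sum_(1 <= p < N.+1 | prime p && (p == n %[mod m])) lg p / p%:R
      - lg N / (totient m)%:R| <= K.
Proof.
move=> m0 n0 cnm.
have [G] : inhabited (dirichlet_characters m).
  by have [m1|m1] := ltnP 1 m; [exact: characters_exist |
    have -> : m = 1%N by apply/eqP; rewrite eqn_leq m1]; exact: characters_mod1.
have [K hK] := mertens_mangoldt G m0 n0 cnm.
exists (K + 4) => N N0; have := hK N N0.
rewrite (bigID prime) /=; set A := \sum_(_ <= _ < _ | _) _.
set B := \sum_(_ <= _ < _ | _) _; set D := \sum_(_ <= _ < _ | _) _.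
have -> : D = A.
  rewrite /D /A big_seq_cond [RHS]big_seq_cond; apply: eq_big => [p|p].
    by rewrite [prime p && _]andbC.
  by move=> /andP[_ /andP[pp _]]; rewrite mangoldt_prime.
have T0 d : 0 <= mangoldt d / d%:R by apply: divr_ge0 => //; exact: mangoldt_ge0.
have B0 : 0 <= B by apply: sumr_ge0.
have B4 : B <= 4.
  apply: le_trans (sum_mangoldt_nonprime N); rewrite /B big_mkcond [leRHS]big_mkcond.
  by apply: ler_sum => d _; case: (prime d); rewrite ?andbF //= ?andbT; case: ifP.
by rewrite !ler_norml => /andP[h1 h2]; apply/andP; split; lra.
Qed.

(** * From the sum of [lg p / p] to the sum of [1 / p] by partial summation *)

Section SecondMertens.
Variables (m : nat) (P : pred nat) (phi K : R).
Hypotheses (phi1 : 1 <= phi) (P1 : ~~ P 1%N)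
  (hK : forall N, (0 < N)%N ->
    `|\sum_(1 <= p < N.+1 | P p) lg p / p%:R - lg N / phi| <= K).

Lemma lg_gt0 n : (1 < n)%N -> 0 < lg n.
Proof.
move=> n1; apply: lt_le_trans (_ : lg 2 <= _); last exact: lg_le.
apply: lt_le_trans (_ : 2%:R^-1 <= _); first by rewrite invr_gt0.
by have := lgS_lb (n := 1) isT; rewrite lg1 subr0.
Qed.

(** The increments of the error in [hK]: their sums up to [N] are bounded by [K], so Abel summation
    with weights [1 / lg n] applies. *)
Let delta n : R := (if P n then lg n / n%:R else 0) - (lg n - lg n.-1) / phi.

Let delta_sum N : (0 < N)%N ->
  \sum_(2 <= n < N.+1) delta n = \sum_(1 <= p < N.+1 | P p) lg p / p%:R - lg N / phi.
Proof.
case: N => // N _; elim: N => [|N IH].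
  by rewrite big_geq // big_mkcond big_nat1 (negPf P1) lg1 mul0r subr0.
rewrite big_nat_recr //= IH [in RHS]big_mkcond big_nat_recr //= -big_mkcond /delta /=.
by ring.
Qed.

Let inv_lg_decreasing n : (1 < n)%N -> 0 <= (lg n.+1)^-1 <= (lg n)^-1.
Proof.
move=> n1; rewrite invr_ge0 lg_ge0 /= lef_pV2 ?posrE ?lg_gt0 //; last exact: ltnW.
by apply: lg_le => //; apply: ltnW.
Qed.

Lemma recip_delta_bound a b : (1 < a <= b)%N ->
  `|\sum_(a.+1 <= n < b.+1) delta n / lg n| <= 2 * K / lg a.
Proof.
move=> /andP[a1 ab]; have a0 := ltnW a1.
have K0 : 0 <= K by apply: le_trans (hK a0).
rewrite -normc_real rmorph_sum.
under eq_bigr do rewrite mulrC rmorphM.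
apply: le_trans (_ : 2 * K * (lg a.+1)^-1 <= _); last first.
  by apply: ler_wpM2l; [apply: mulr_ge0 | have /andP[] := inv_lg_decreasing a1].
apply: (@abel_bound (fun n => (delta n)%:C) (fun n => (lg n)^-1)).
- by rewrite ltnS.
- by move=> n an; apply: inv_lg_decreasing; apply: leq_trans an; rewrite ltnW.
- by rewrite invr_ge0 lg_ge0.
move=> [|n] /andP[an nb]; first by [].
rewrite -rmorph_sum normc_real.
have -> : \sum_(a.+1 <= i < n.+1) delta i =
   \sum_(2 <= i < n.+1) delta i - \sum_(2 <= i < a.+1) delta i.
  by rewrite (big_cat_nat (m := 2) (n := a.+1) (p := n.+1)) //= addrAC subrr add0r.
have n0 : (0 < n)%N by exact: leq_trans a0 an.
rewrite !delta_sum //.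
have := hK n0; have := hK a0.
rewrite !ler_norml => /andP[u1 u2] /andP[v1 v2]; apply/andP; split; lra.
Qed.

Let loglog n := Rpower.ln (lg n).

(** Compares the integral of [1 / u] from [lg n] to [lg n.+1] with its lower rectangle. The error is
    bounded by a telescoping difference because [lg n.+1 - lg n <= 1]. *)
Lemma loglogS n : (1 < n)%N ->
  0 <= loglog n.+1 - loglog n - (lg n.+1 - lg n) / lg n.+1 <= (lg n)^-1 - (lg n.+1)^-1.
Proof.
move=> n1; have v0 := lg_gt0 n1; have u0 : 0 < lg n.+1 by apply: lg_gt0; apply: ltnW.
have n0 := ltnW n1.
have d0 : 0 <= lg n.+1 - lg n by rewrite subr_ge0; apply: lg_le.
have d1 : lg n.+1 - lg n <= 1.
  by apply: le_trans (lgS_ub n0) _; rewrite invf_le1 ?ltr0n // ler1n.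
rewrite /loglog -ln_div //; move: v0 u0 d0 d1; move: (lg n.+1) (lg n) => u v v0 u0 d0 d1.
have uv0 : 0 < u / v by exact: divr_gt0.
have := ln_le_sub1 uv0; have := lnV_lb uv0; rewrite invf_div => h1 h2.
have e1 : (u - v) / u = 1 - v / u by field; rewrite gt_eqF.
have e2 : u / v - 1 = (u - v) / v by field; rewrite gt_eqF.
have vi : 0 <= v^-1 - u^-1.
  rewrite subr_ge0 lef_pV2 ?posrE //; lra.
have h3 : (u - v) * (v^-1 - u^-1) <= 1 * (v^-1 - u^-1) by apply: ler_wpM2r.
have h4 : (u - v) / v - (u - v) / u = (u - v) * (v^-1 - u^-1) by rewrite mulrBr.
apply/andP; split; lra.
Qed.

(** The part [2 * K] comes from Abel summation of [delta], the part 1 from the telescoped errors of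
    [loglogS], which dividing by [phi >= 1] does not increase. *)
Lemma recip_sum_diff a b : (1 < a <= b)%N ->
  `|(\sum_(1 <= p < b.+1 | P p) p%:R^-1 - loglog b / phi) -
    (\sum_(1 <= p < a.+1 | P p) p%:R^-1 - loglog a / phi)| <= (2 * K + 1) / lg a.
Proof.
move=> hab; have /andP[a1 ab] := hab; have p0 : 0 < phi := lt_le_trans ltr01 phi1.
have := recip_delta_bound hab.
have l0 := lg_gt0 a1.
set X := \sum_(_ <= _ < _) _.
have h : 0 <= (loglog b - loglog a) - \sum_(a.+1 <= n < b.+1) (lg n - lg n.-1) / lg n
           <= (lg a)^-1 - (lg b)^-1.
  elim: b ab {hab X} => [|b IH]; first by rewrite leqn0 => /eqP h; rewrite h in a1.
  rewrite leq_eqVlt => /orP[/eqP<-|ab]; first by rewrite big_geq // !subrr ?subr0 lexx.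
  have /andP[i1 i2] := IH ab; have b1 : (1 < b)%N := leq_trans a1 ab.
  have /andP[j1 j2] := loglogS b1; rewrite big_nat_recr //=.
  by apply/andP; split; lra.
have l1 : 0 < lg b by apply: lg_gt0; apply: leq_trans ab.
have -> : (\sum_(1 <= p < b.+1 | P p) p%:R^-1 - loglog b / phi) -
    (\sum_(1 <= p < a.+1 | P p) p%:R^-1 - loglog a / phi) =
  X - ((loglog b - loglog a) - \sum_(a.+1 <= n < b.+1) (lg n - lg n.-1) / lg n) / phi.
  rewrite (big_cat_nat (n := a.+1) (p := b.+1)) //=.
  have -> : X = \sum_(a.+1 <= p < b.+1 | P p) p%:R^-1 -
      (\sum_(a.+1 <= n < b.+1) (lg n - lg n.-1) / lg n) / phi.
    rewrite /X [in RHS]big_mkcond mulr_suml -sumrB big_seq [RHS]big_seq; apply: eq_bigr => n.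
    rewrite mem_index_iota => /andP[an _]; rewrite /delta mulrBl.
    have ln0 : lg n != 0 by rewrite gt_eqF // lg_gt0 //; apply: leq_trans an; rewrite ltnW.
    congr (_ - _); last by rewrite mulrAC.
    by case: ifP => _; rewrite ?mul0r // mulrAC divff // mul1r.
  by ring.
have i1 : 0 < (lg a)^-1 by rewrite invr_gt0.
have i2 : 0 < (lg b)^-1 by rewrite invr_gt0.
move: h; set Y := loglog b - loglog a - _ => /andP[y1 y2].
have y3 : 0 <= Y / phi by apply: divr_ge0 => //; exact: ltW.
have y4 : Y / phi <= Y by rewrite ler_pdivrMr // ler_peMr.
rewrite mulrDl mul1r !ler_norml => /andP[x1 x2]; apply/andP; split; lra.
Qed.

Lemma second_mertens : exists M C, 0 <= C /\ forall N, (1 < N)%N ->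
  `|M - (\sum_(1 <= p < N.+1 | P p) p%:R^-1 - loglog N / phi)| <= C / lg N.
Proof.
have K0 : 0 <= K by apply: le_trans (hK (ltn0Sn 0)).
have C0 : 0 <= 2 * K + 1 by lra.
pose u N := \sum_(1 <= p < N.+3 | P p) p%:R^-1 - loglog N.+2 / phi.
have [||M hM] := @cauchy_limit u (fun N => (2 * K + 1) / lg N.+2).
- by move=> n; apply: divr_ge0 => //; exact: lg_ge0.
- by move=> a b ab; apply: recip_sum_diff; rewrite !ltnS ab.
exists M, (2 * K + 1); split=> // -[|[|N]] // _; exact: hM.
Qed.

End SecondMertens.

(** * Translation to Stdlib's reals, lists and arithmetic *)

Lemma fold_rightE (F : nat -> R) (s : seq nat) :
  List.fold_right Rdefinitions.Rplus 0 (List.map F s) = \sum_(i <- s) F i.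
Proof. by elim: s => [|a s IH] /=; rewrite ?big_nil // big_cons IH. Qed.

Lemma list_seqE a k : List.seq a k = iota a k.
Proof. by elim: k a => //= k IH a; rewrite IH. Qed.

Lemma Nat_moduloE a b : (0 < b)%N -> PeanoNat.Nat.modulo a b = (a %% b)%N.
Proof.
move=> b0; have bn : b <> 0%N by case: b b0.
have := PeanoNat.Nat.div_mod a b bn; have /ssrnat.ltP := PeanoNat.Nat.mod_upper_bound a b bn.
set q := PeanoNat.Nat.div a b; set r := PeanoNat.Nat.modulo a b => rb aE.
have -> : a = (q * b + r)%N by rewrite {1}aE mulnC.
by rewrite modnMDl modn_small.
Qed.

Lemma coprime_of_Nat_gcd a b : PeanoNat.Nat.gcd a b = 1%N -> coprime b a.
Proof.
move=> g1; have /dvdnP[u hu] := dvdn_gcdl b a; have /dvdnP[v hv] := dvdn_gcdr b a.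
have := PeanoNat.Nat.gcd_greatest a b (gcdn b a) (ex_intro _ v hv) (ex_intro _ u hu).
rewrite g1 => -[w hw]; rewrite /coprime -dvdn1; apply/dvdnP; by exists w.
Qed.

Lemma prime_class_recip_sum m n N (x : R) : (0 < m)%N ->
  BinInt.Z.to_nat (Rdefinitions.up x) = N.+1 -> Rdefinitions.Rle (Raxioms.INR N) x ->
  prime_class_sum (fun p => Rdefinitions.Rinv (Raxioms.INR p)) x m n =
  \sum_(1 <= p < N.+1 | prime p && (p == n %[mod m])) p%:R^-1.
Proof.
move=> m0 upx Nx; rewrite /prime_class_sum upx fold_rightE list_seqE.
rewrite -[iota 0 N.+1]/(index_iota 0 N.+1) big_ltn //.
rewrite [prime_in_class m n 0]/= add0r [RHS]big_mkcond big_seq [RHS]big_seq.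
apply: eq_bigr => p; rewrite mem_index_iota => /andP[_ pN].
have px : Rdefinitions.Rle (Raxioms.INR p) x.
  apply: RIneq.Rle_trans Nx; apply: RIneq.le_INR; apply/ssrnat.leP; exact: pN.
rewrite /prime_in_class !Nat_moduloE //.
have -> : PeanoNat.Nat.eqb (p %% m)%N (n %% m)%N = (p == n %[mod m]).
  by apply/idP/eqP => [/PeanoNat.Nat.eqb_eq|->] //; exact: PeanoNat.Nat.eqb_refl.
by case: ifP => // _; case: RIneq.Rle_dec => // _; rewrite INRE.
Qed.

(** Mertens' theorem as handed to the evaluation of the integral, hence in Stdlib terms throughout.
    The conditions on [N] and [x] make [N] the integer part of [x]; [1 < N] keeps the inner
    logarithm positive. *)
Lemma recip_sum_asymptotics m n : Peano.lt 0 m -> Peano.lt 0 n -> PeanoNat.Nat.gcd m n = 1%N ->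
  exists M C : R, Rdefinitions.Rle Rdefinitions.R0 C /\ forall N (x : R), Peano.lt 1 N ->
    BinInt.Z.to_nat (Rdefinitions.up x) = S N -> Rdefinitions.Rle (Raxioms.INR N) x ->
    Rdefinitions.Rle (Rbasic_fun.Rabs (Rdefinitions.Rminus
      (prime_class_sum (fun p => Rdefinitions.Rinv (Raxioms.INR p)) x m n)
      (Rdefinitions.Rplus M (Rdefinitions.Rdiv
         (Rpower.ln (Rpower.ln (Raxioms.INR N))) (Raxioms.INR (Pilot.Defs.phi m))))))
      (Rdefinitions.Rdiv C (Rpower.ln (Raxioms.INR N))).
Proof.
move=> /ssrnat.ltP m0 /ssrnat.ltP n0 g1; have cnm := coprime_of_Nat_gcd g1.
have [K hK] := mertens_class m0 n0 cnm.
have phi1 : 1 <= (totient m)%:R :> R by rewrite ler1n totient_gt0.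
have P1 : ~~ (prime 1 && (1 == n %[mod m])) by [].
have [M [C [C0 h]]] := second_mertens phi1 P1 hK.
exists M, C; split; first exact/RleP.
move=> N x /ssrnat.ltP N1 upx Nx; apply/RleP.
rewrite (prime_class_recip_sum n m0 upx Nx) RabsE RminusE RplusE !RdivE !INRE.
apply: le_trans (h N N1); rewrite -normrN le_eqVlt; apply/orP; left; apply/eqP.
congr (`|_|); rewrite /lg /Pilot.Defs.phi; ring.
Qed.

Lemma INR_phi_ge1 m : Peano.lt 0 m -> Rdefinitions.Rle 1 (Raxioms.INR (Pilot.Defs.phi m)).
Proof. by move=> /ssrnat.ltP m0; apply/RleP; rewrite INRE ler1n totient_gt0. Qed.

End Mertens.

From Stdlib Require Import Reals List Lra Lia ZArith.
From Coquelicot Require Import Coquelicot.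
Open Scope R_scope.

(** * Evaluation of the integral *)

Definition class_term (w : nat -> R) (x : R) (m n p : nat) : R :=
  if prime_in_class m n p then (if Rle_dec (INR p) x then w p else 0) else 0.

Definition lsum (l : list nat) (F : nat -> R) : R := fold_right Rplus 0 (map F l).

Lemma lsum_ext l F G : (forall p, In p l -> F p = G p) -> lsum l F = lsum l G.
Proof.
  unfold lsum; induction l as [|a l IH]; intros H; [reflexivity|simpl].
  rewrite H by now left. f_equal. apply IH. intros; apply H; now right.
Qed.

Lemma lsum_plus l F G : lsum l (fun p => F p + G p) = lsum l F + lsum l G.
Proof. unfold lsum; induction l as [|a l IH]; simpl; [ring|rewrite IH; ring]. Qed.

Lemma lsum_scal l c F : lsum l (fun p => c * F p) = c * lsum l F.
Proof. unfold lsum; induction l as [|a l IH]; simpl; [ring|rewrite IH; ring]. Qed.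

Lemma lsum_le l F G : (forall p, F p <= G p) -> lsum l F <= lsum l G.
Proof.
  intros H; unfold lsum; induction l as [|a l IH]; simpl; [lra|].
  specialize (H a); lra.
Qed.

Lemma lsum_0 l F : (forall p, In p l -> F p = 0) -> lsum l F = 0.
Proof.
  unfold lsum; induction l as [|a l IH]; intros H; [reflexivity|simpl].
  rewrite H by now left. rewrite IH; [ring|]. intros; apply H; now right.
Qed.

Lemma lsum_app l1 l2 F : lsum (l1 ++ l2) F = lsum l1 F + lsum l2 F.
Proof. unfold lsum; induction l1 as [|a l IH]; simpl; [ring|rewrite IH; ring]. Qed.

Lemma is_RInt_zero a b : is_RInt (fun _ => 0) a b 0.
Proof.
  evar_last; [apply @is_RInt_const|].
  unfold scal; simpl; unfold mult; simpl; ring.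
Qed.

Lemma is_RInt_lsum l (F : nat -> R -> R) (I : nat -> R) a b :
  (forall p, is_RInt (F p) a b (I p)) ->
  is_RInt (fun t => lsum l (fun p => F p t)) a b (lsum l I).
Proof.
  intros H; unfold lsum; induction l as [|p l IH]; simpl.
  - apply is_RInt_zero.
  - now apply @is_RInt_plus.
Qed.

Lemma up_le x y : x <= y -> (Z.to_nat (up x) <= Z.to_nat (up y))%nat.
Proof.
  intros H. destruct (archimed x) as [_ H1]. destruct (archimed y) as [H2 _].
  assert (up x < up y + 1)%Z by (apply lt_IZR; rewrite plus_IZR; lra).
  lia.
Qed.

Lemma lt_up x p : (Z.to_nat (up x) <= p)%nat -> x < INR p.
Proof.
  intros H. destruct (archimed x) as [H1 _].
  assert (H2 : (up x <= Z.of_nat p)%Z) by lia.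
  apply IZR_le in H2. rewrite <- INR_IZR_INZ in H2. lra.
Qed.

Lemma floor_exists x : 0 <= x ->
  exists N, Z.to_nat (up x) = S N /\ INR N <= x < INR N + 1.
Proof.
  intros H. destruct (archimed x) as [H1 H2].
  assert (H3 : (0 < up x)%Z) by (apply lt_IZR; lra).
  exists (Z.to_nat (up x - 1)). rewrite INR_IZR_INZ, Z2Nat.id, minus_IZR by lia.
  split; [lia|lra].
Qed.

(** A common range lets sums with different bounds [x] be compared term by term; the added entries
    fail the test [INR p <= x]. *)
Lemma prime_class_sumE w x m n K : (Z.to_nat (up x) <= K)%nat ->
  prime_class_sum w x m n = lsum (seq 0 K) (class_term w x m n).
Proof.
  intros H. set (a := Z.to_nat (up x)) in *.
  replace K with (a + (K - a))%nat by lia.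
  rewrite seq_app, lsum_app, (lsum_0 (seq (0 + a) (K - a))).
  { rewrite Rplus_0_r. reflexivity. }
  intros p Hp; apply in_seq in Hp; unfold class_term.
  destruct (prime_in_class m n p); [|reflexivity].
  destruct Rle_dec as [h|]; [|reflexivity].
  assert (x < INR p) by (apply lt_up; fold a; lia). lra.
Qed.

Lemma prime_in_class_ge2 m n p : prime_in_class m n p = true -> 2 <= INR p.
Proof.
  intros H. destruct p as [|[|p]]; [discriminate|discriminate|].
  rewrite !S_INR. pose proof (pos_INR p). lra.
Qed.

Lemma class_term_lin w v x m n p a b :
  class_term (fun p => a * w p + b * v p) x m n p =
  a * class_term w x m n p + b * class_term v x m n p.
Proof.
  unfold class_term. destruct prime_in_class; [|ring]. destruct Rle_dec; ring.
Qed.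

Lemma prime_class_sum_lin w v x m n a b :
  prime_class_sum (fun p => a * w p + b * v p) x m n =
  a * prime_class_sum w x m n + b * prime_class_sum v x m n.
Proof.
  rewrite !(prime_class_sumE _ _ _ _ (Z.to_nat (up x))) by lia.
  rewrite <- !lsum_scal, <- lsum_plus. apply lsum_ext; intros. apply class_term_lin.
Qed.

Lemma prime_class_sum_ext w v x m n : (forall p, 2 <= INR p -> w p = v p) ->
  prime_class_sum w x m n = prime_class_sum v x m n.
Proof.
  intros H. rewrite !(prime_class_sumE _ _ _ _ (Z.to_nat (up x))) by lia.
  apply lsum_ext; intros p _. unfold class_term.
  destruct (prime_in_class m n p) eqn:E; [|reflexivity].
  rewrite H; [reflexivity|]. eapply prime_in_class_ge2; eauto.
Qed.

(** * The contribution of a single prime to the integral *)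

Lemma Rpower_pos x y : 0 < Rpower x y.
Proof. apply exp_pos. Qed.

Lemma is_derive_Rpower_neg c t : 0 < c -> 0 < t ->
  is_derive (fun t => - Rpower t (- c) / c) t (/ Rpower t (c + 1)).
Proof.
  intros Hc Ht. unfold Rpower. auto_derive; [lra|].
  replace (- c * ln t) with (- ((c + 1) * ln t) + ln t) by ring.
  rewrite exp_plus, exp_Ropp, exp_ln by lra.
  field. repeat split; try lra. apply Rgt_not_eq, exp_pos.
Qed.

Lemma is_RInt_Rpower_neg c a x : 0 < c -> 0 < a -> a <= x ->
  is_RInt (fun t => / Rpower t (c + 1)) a x ((Rpower a (- c) - Rpower x (- c)) / c).
Proof.
  intros Hc Ha Hx.
  replace ((Rpower a (- c) - Rpower x (- c)) / c)
    with (minus (- Rpower x (- c) / c) (- Rpower a (- c) / c))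
    by (unfold minus, plus, opp; simpl; field; lra).
  apply (@is_RInt_derive R_CompleteNormedModule (fun t => - Rpower t (- c) / c)).
  - intros t Ht. rewrite Rmin_left, Rmax_right in Ht by lra.
    apply is_derive_Rpower_neg; lra.
  - intros t Ht. rewrite Rmin_left, Rmax_right in Ht by lra.
    apply (ex_derive_continuous (fun t => / Rpower t (c + 1))).
    unfold Rpower. auto_derive. split; [lra|]. split; [|trivial].
    apply Rgt_not_eq, exp_pos.
Qed.

Lemma is_RInt_step c a x : 0 < c -> 1 <= a -> 1 <= x ->
  is_RInt (fun t => if Rle_dec a t then / Rpower t (c + 1) else 0) 1 x
    (if Rle_dec a x then (Rpower a (- c) - Rpower x (- c)) / c else 0).
Proof.
  intros Hc Ha Hx.
  assert (Z : forall b, 1 <= b -> b <= a ->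
    is_RInt (fun t => if Rle_dec a t then / Rpower t (c + 1) else 0) 1 b 0).
  { intros b Hb Hba. apply (is_RInt_ext (fun _ => 0)).
    - intros t Ht. rewrite Rmin_left, Rmax_right in Ht by lra.
      destruct Rle_dec; [lra|reflexivity].
    - apply is_RInt_zero. }
  destruct (Rle_dec a x) as [h|h]; [|apply Z; lra].
  replace ((Rpower a (- c) - Rpower x (- c)) / c)
    with (plus 0 ((Rpower a (- c) - Rpower x (- c)) / c))
    by (unfold plus; simpl; ring).
  apply (@is_RInt_Chasles R_NormedModule _ 1 a x); [apply Z; lra|].
  apply (is_RInt_ext (fun t => / Rpower t (c + 1))).
  - intros t Ht. rewrite Rmin_left, Rmax_right in Ht by lra.
    destruct Rle_dec; [reflexivity|lra].
  - apply is_RInt_Rpower_neg; lra.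
Qed.

Section Integral.
Variables (k : R) (m n : nat).
Hypothesis Hk : -1 < k.
Let c := k + 1.
Let s (x : R) := prime_class_sum (fun p => / INR p) x m n.

(** Turns the prime's entry into [prime_pi (Rpower t c)] into a step in [t] located at [p^(1/c)], so
    that [is_RInt_step] serves both sums without a change of variable. *)
Lemma Rle_Rpower_root t p : 0 < t -> 0 < p ->
  (p <= Rpower t c <-> Rpower p (/ c) <= t).
Proof.
  intros Ht Hp. assert (Hc : 0 < c) by (unfold c; lra). split; intros H.
  - replace t with (Rpower (Rpower t c) (/ c))
      by (rewrite Rpower_mult, Rinv_r, Rpower_1; lra).
    apply Rle_Rpower_l; [apply Rlt_le, Rinv_0_lt_compat|]; lra.
  - replace p with (Rpower (Rpower p (/ c)) c)
      by (rewrite Rpower_mult, Rinv_l, Rpower_1; lra).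
    apply Rle_Rpower_l; [lra|]. split; [apply Rpower_pos|assumption].
Qed.

Lemma RInt_prime_difference x : 1 <= x ->
  RInt (fun t => (prime_pi_k k t m n - prime_pi (Rpower t (k + 1)) m n)
                   / Rpower t (k + 2)) 1 x =
  (s x - s (Rpower x c) - prime_pi_k k x m n / Rpower x c
     + prime_pi (Rpower x c) m n / Rpower x c) / c.
Proof.
  intros Hx. assert (Hc : 0 < c) by (unfold c; lra).
  set (y := Rpower x c).
  set (K := Nat.max (Z.to_nat (up x)) (Z.to_nat (up y))).
  set (F1 := fun (p : nat) (t : R) => if prime_in_class m n p
    then Rpower (INR p) k * (if Rle_dec (INR p) t then / Rpower t (c + 1) else 0) else 0).
  set (F2 := fun (p : nat) (t : R) => if prime_in_class m n p
    then (if Rle_dec (Rpower (INR p) (/ c)) t then / Rpower t (c + 1) else 0) else 0).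
  (* Both kinds of step have the same main term [1 / (c * p)]: the lower limits contribute
     [p^k * p^(-c) = 1/p] and [(p^(1/c))^(-c) = 1/p]. The upper limit [x] contributes the terms with
     [1 / y]. *)
  set (I1 := class_term (fun p => / c * / INR p + (- / (c * y)) * Rpower (INR p) k) x m n).
  set (I2 := class_term (fun p => / c * / INR p + (- / (c * y)) * 1) y m n).
  assert (Ey : / y = Rpower x (- c)) by (unfold y; now rewrite Rpower_Ropp).
  assert (Hy : 0 < y) by apply Rpower_pos.
  assert (H1 : forall p, is_RInt (F1 p) 1 x (I1 p)).
  { intros p. unfold F1, I1, class_term.
    destruct (prime_in_class m n p) eqn:E; [|apply is_RInt_zero].
    apply prime_in_class_ge2 in E.
    replace (if Rle_dec (INR p) x then / c * / INR p + - / (c * y) * Rpower (INR p) k else 0)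
      with (scal (Rpower (INR p) k) (if Rle_dec (INR p) x
              then (Rpower (INR p) (- c) - Rpower x (- c)) / c else 0)).
    - apply (is_RInt_scal (fun t => if Rle_dec (INR p) t then / Rpower t (c + 1) else 0)).
      apply is_RInt_step; lra.
    - unfold scal; simpl; unfold mult; simpl. destruct Rle_dec; [|ring].
      rewrite <- Ey. replace (/ INR p) with (Rpower (INR p) k * Rpower (INR p) (- c)).
      + field. lra.
      + rewrite <- Rpower_plus. replace (k + - c) with (Ropp 1) by (unfold c; ring).
        rewrite Rpower_Ropp, Rpower_1 by lra. reflexivity. }
  assert (H2 : forall p, is_RInt (F2 p) 1 x (I2 p)).
  { intros p. unfold F2, I2, class_term.
    destruct (prime_in_class m n p) eqn:E; [|apply is_RInt_zero].
    apply prime_in_class_ge2 in E.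
    replace (if Rle_dec (INR p) y then / c * / INR p + - / (c * y) * 1 else 0)
      with (if Rle_dec (Rpower (INR p) (/ c)) x
              then (Rpower (Rpower (INR p) (/ c)) (- c) - Rpower x (- c)) / c else 0).
    - apply is_RInt_step; try lra.
      rewrite <- (Rpower_O (INR p)) by lra.
      apply Rle_Rpower; [lra|apply Rlt_le, Rinv_0_lt_compat; lra].
    - destruct (Rle_Rpower_root x (INR p)) as [a b]; try lra. fold y in a, b.
      destruct (Rle_dec (INR p) y); destruct Rle_dec; try reflexivity; try tauto.
      rewrite Rpower_mult, <- Ey.
      replace (/ c * - c) with (Ropp 1) by (field; lra).
      rewrite Rpower_Ropp, Rpower_1 by lra. field. lra. }
  assert (Hint : is_RInt (fun t => minus (lsum (seq 0 K) (fun p => F1 p t))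
      (lsum (seq 0 K) (fun p => F2 p t))) 1 x
      (minus (lsum (seq 0 K) I1) (lsum (seq 0 K) I2))).
  { apply @is_RInt_minus; now apply is_RInt_lsum. }
  assert (E1 : lsum (seq 0 K) I1 = / c * s x + (- / (c * y)) * prime_pi_k k x m n).
  { unfold I1. rewrite <- prime_class_sumE by apply Nat.le_max_l.
    rewrite prime_class_sum_lin. reflexivity. }
  assert (E2 : lsum (seq 0 K) I2 = / c * s y + (- / (c * y)) * prime_pi y m n).
  { unfold I2. rewrite <- prime_class_sumE by apply Nat.le_max_r.
    rewrite (prime_class_sum_lin _ (fun _ => 1)). reflexivity. }
  rewrite E1, E2 in Hint. apply is_RInt_unique.
  replace ((s x - s y - prime_pi_k k x m n / y + prime_pi y m n / y) / c) with
    (minus (/ c * s x + (- / (c * y)) * prime_pi_k k x m n)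
           (/ c * s y + (- / (c * y)) * prime_pi y m n))
    by (unfold minus, plus, opp; simpl; field; lra).
  revert Hint. apply is_RInt_ext. intros t Ht.
  rewrite Rmin_left, Rmax_right in Ht by lra.
  unfold minus, plus, opp; simpl.
  replace (k + 2) with (c + 1) by (unfold c; ring).
  assert (Hcx : Rpower t c <= y) by (apply Rle_Rpower_l; lra).
  unfold prime_pi_k, prime_pi.
  rewrite (prime_class_sumE _ t _ _ K)
    by (eapply Nat.le_trans; [apply up_le|apply Nat.le_max_l]; lra).
  fold c. rewrite (prime_class_sumE _ (Rpower t c) _ _ K)
    by (eapply Nat.le_trans; [apply up_le, Hcx|apply Nat.le_max_r]).
  unfold Rdiv. rewrite Rmult_minus_distr_r, !(Rmult_comm (lsum _ (class_term _ _ _ _))).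
  rewrite <- !lsum_scal. unfold Rminus. f_equal; [|f_equal]; apply lsum_ext; intros p _;
    unfold F1, F2, class_term; destruct (prime_in_class m n p) eqn:E; try ring.
  - destruct Rle_dec; ring.
  - apply prime_in_class_ge2 in E. destruct (Rle_Rpower_root t (INR p)) as [a b]; try lra.
    destruct (Rle_dec (INR p) (Rpower t c)); destruct Rle_dec; try ring; tauto.
Qed.

End Integral.

(** * Limits as [x] tends to infinity *)

Lemma ln_le_minus_1 u : 0 < u -> ln u <= u - 1.
Proof.
  intros H. pose proof (exp_ineq1_le (ln u)) as H1. rewrite exp_ln in H1; lra.
Qed.

Lemma is_lim_Rpower_p d : 0 < d -> is_lim (fun x => Rpower x d) p_infty p_infty.
Proof.
  intros Hd. unfold Rpower.
  apply (is_lim_comp exp (fun x => d * ln x) p_infty p_infty p_infty).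
  - apply is_lim_exp_p.
  - evar_last; [apply is_lim_scal_l, is_lim_ln_p|].
    simpl. destruct Rle_dec as [h|h]; [|lra].
    destruct Rle_lt_or_eq_dec; [reflexivity|lra].
  - apply filter_forall; discriminate.
Qed.

Lemma is_lim_Rpower_neg d : 0 < d -> is_lim (fun x => Rpower x (- d)) p_infty 0.
Proof.
  intros Hd. apply (is_lim_ext (fun x => / Rpower x d)).
  { intros y. now rewrite Rpower_Ropp. }
  evar_last; [apply is_lim_inv; [apply is_lim_Rpower_p; lra|discriminate]|reflexivity].
Qed.

Lemma near_p_infty_gt a : Rbar_locally' p_infty (fun x => a < x).
Proof. now exists a. Qed.

Section Limit.
Variables (m n : nat).
Hypotheses (Hm : (0 < m)%nat) (Hn : (0 < n)%nat) (Hg : Nat.gcd m n = 1%nat).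
Let s (x : R) := prime_class_sum (fun p => / INR p) x m n.
Let ph := INR (phi m).

Lemma phi_ge1 : 1 <= ph.
Proof. exact (Mertens.INR_phi_ge1 Hm). Qed.

Lemma recip_sum_loglog : exists M : R,
  is_lim (fun x => s x - ln (ln x) / ph) p_infty M.
Proof.
  destruct (Mertens.recip_sum_asymptotics Hm Hn Hg) as [M [C [HC H]]].
  pose proof phi_ge1 as Hph.
  exists M. apply is_lim_spec. intros eps. pose proof (cond_pos eps) as He.
  (* Passing from the integer part [N] to [x] moves [ln (ln x)] by at most [1 / ln N], so the total
     error is at most [(C + 1) / ln N]. This is below [eps] once [ln N > T], which [x > exp T + 1]
     ensures. *)
  set (T := (C + 1) / eps + 1).
  assert (HT0 : 0 <= (C + 1) / eps) by (apply Rle_mult_inv_pos; lra).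
  assert (HT : 1 <= T) by (unfold T; lra).
  assert (HTe : C + 1 < eps * T).
  { unfold T. replace (eps * ((C + 1) / eps + 1)) with (C + 1 + eps) by (field; lra). lra. }
  exists (exp T + 1). intros x Hx.
  pose proof (exp_pos T) as HeT. pose proof (exp_ineq1_le T) as HeT1.
  destruct (floor_exists x) as [N [HN1 [HN2 HN3]]]; [lra|].
  assert (HN : exp T < INR N) by lra.
  assert (HN4 : (1 < N)%nat) by (apply INR_lt; simpl; lra).
  assert (HlT : T < ln (INR N)) by (rewrite <- (ln_exp T); apply ln_increasing; lra).
  specialize (H N x HN4 HN1 HN2).
  assert (Hle : ln (INR N) <= ln x) by (apply ln_le; lra).
  assert (Hd : ln x - ln (INR N) <= 1).
  { rewrite <- ln_div by lra.
    eapply Rle_trans; [apply ln_le_minus_1, Rdiv_lt_0_compat; lra|].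
    apply (Rmult_le_reg_r (INR N)); [lra|]. field_simplify; lra. }
  assert (Hdd : 0 <= ln (ln x) - ln (ln (INR N)) <= / ln (INR N)).
  { split; [apply Rle_minus_r; rewrite Rplus_0_l; apply ln_le; lra|].
    rewrite <- ln_div by lra.
    eapply Rle_trans; [apply ln_le_minus_1, Rdiv_lt_0_compat; lra|].
    apply (Rmult_le_reg_r (ln (INR N))); [lra|]. field_simplify; lra. }
  assert (Hq : 0 <= (ln (ln x) - ln (ln (INR N))) / ph <= / ln (INR N)).
  { split; [apply Rle_mult_inv_pos; lra|].
    apply (Rmult_le_reg_r ph); [lra|]. unfold Rdiv. rewrite Rmult_assoc, Rinv_l by lra.
    assert (0 < / ln (INR N)) by (apply Rinv_0_lt_compat; lra). nra. }
  assert (HCT : C / ln (INR N) + / ln (INR N) < eps).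
  { replace (C / ln (INR N) + / ln (INR N)) with ((C + 1) / ln (INR N)) by (field; lra).
    apply (Rmult_lt_reg_r (ln (INR N))); [lra|].
    unfold Rdiv. rewrite Rmult_assoc, Rinv_l by lra. nra. }
  fold (s x) ph in H.
  replace (s x - ln (ln x) / ph - M) with
    ((s x - (M + ln (ln (INR N)) / ph)) - (ln (ln x) - ln (ln (INR N))) / ph)
    by (field; lra).
  eapply Rle_lt_trans; [apply Rabs_triang|].
  rewrite Rabs_Ropp, (Rabs_pos_eq (_ / ph)) by lra. lra.
Qed.

(** Mertens' constant [M] cancels, and [ln (ln (x^a)) = ln a + ln (ln x)]. *)
Lemma recip_sum_ratio a : 0 < a ->
  is_lim (fun x => s x - s (Rpower x a)) p_infty (- ln a / ph).
Proof.
  intros Ha. destruct recip_sum_loglog as [M HM]. pose proof phi_ge1.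
  assert (HM' : is_lim (fun x => s (Rpower x a) - ln (ln (Rpower x a)) / ph) p_infty M).
  { apply (is_lim_comp (fun y => s y - ln (ln y) / ph) (fun x => Rpower x a)
      p_infty M p_infty); [exact HM|now apply is_lim_Rpower_p|].
    apply filter_forall; discriminate. }
  apply (is_lim_ext_loc (fun x => ((s x - ln (ln x) / ph)
    - (s (Rpower x a) - ln (ln (Rpower x a)) / ph)) + (- ln a / ph))).
  - exists 1. intros x Hx. assert (0 < ln x) by (rewrite <- ln_1; apply ln_increasing; lra).
    unfold Rpower at 2. rewrite ln_exp, ln_mult by lra. field. lra.
  - replace (Finite (- ln a / ph)) with (Finite ((M - M) + (- ln a / ph)))
      by (f_equal; ring).
    apply is_lim_plus'; [now apply is_lim_minus'|apply is_lim_const].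
Qed.

Lemma ln_le_Rpower d x : 0 < d -> 0 < x -> ln x <= Rpower x d / d.
Proof.
  intros Hd Hx. apply (Rmult_le_reg_l d); [lra|].
  replace (d * (Rpower x d / d)) with (Rpower x d) by (field; lra).
  unfold Rpower. pose proof (exp_ineq1_le (d * ln x)). lra.
Qed.

(** Half of the decay is spent on [ln (ln x) <= ln x <= x^(d/2) / (d/2)]; the other half tends to
    0. *)
Lemma recip_sum_Rpower_neg d : 0 < d ->
  is_lim (fun x => Rpower x (- d) * s x) p_infty 0.
Proof.
  intros Hd. destruct recip_sum_loglog as [M HM]. pose proof phi_ge1 as Hp.
  assert (H0 := is_lim_Rpower_neg d Hd).
  assert (H2 := is_lim_Rpower_neg (d / 2) ltac:(lra)).
  apply (is_lim_ext_loc (fun x => Rpower x (- d) * (s x - ln (ln x) / ph)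
     + Rpower x (- d) * (ln (ln x) / ph))).
  { exists 0; intros x _. ring. }
  replace (Finite 0) with (Finite (0 * M + 0)) by (f_equal; ring).
  apply is_lim_plus'.
  { evar_last; [apply is_lim_mult; [exact H0|exact HM|exact I]|reflexivity]. }
  apply (is_lim_le_le_loc (fun _ => 0) (fun x => / (d / 2) * Rpower x (- (d / 2)))).
  - exists (exp 1). intros x Hx.
    assert (1 < ln x) by (rewrite <- (ln_exp 1); apply ln_increasing; [apply exp_pos|lra]).
    pose proof (exp_pos 1).
    assert (0 <= ln (ln x)) by (rewrite <- ln_1; apply ln_le; lra).
    assert (ln (ln x) <= ln x) by (pose proof (ln_le_minus_1 (ln x)); lra).
    pose proof (ln_le_Rpower (d / 2) x ltac:(lra) ltac:(lra)) as Hl.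
    pose proof (Rpower_pos x (- d)) as Hr.
    assert (Hq : 0 <= ln (ln x) / ph <= Rpower x (d / 2) / (d / 2)).
    { split; [apply Rle_mult_inv_pos; lra|].
      eapply Rle_trans; [|exact Hl]. apply (Rmult_le_reg_r ph); [lra|].
      unfold Rdiv; rewrite Rmult_assoc, Rinv_l by lra. nra. }
    split; [apply Rmult_le_pos; lra|].
    replace (/ (d / 2) * Rpower x (- (d / 2)))
      with (Rpower x (- d) * (Rpower x (d / 2) / (d / 2))).
    { apply Rmult_le_compat_l; lra. }
    replace (- (d / 2)) with (- d + d / 2) by field.
    rewrite Rpower_plus. field. lra.
  - apply is_lim_const.
  - evar_last; [apply is_lim_scal_l; exact H2|]. simpl. f_equal. ring.
Qed.

Lemma power_sum_bounds c x y : 0 < c -> 0 < y <= x ->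
  0 <= prime_pi_k (c - 1) x m n / Rpower x c <=
  Rpower y c / Rpower x c * s x + (s x - s y).
Proof.
  intros Hc Hy.
  assert (Hxc := Rpower_pos x c). assert (Hyc := Rpower_pos y c).
  assert (Hxy : Rpower y c <= Rpower x c) by (apply Rle_Rpower_l; lra).
  set (K := Z.to_nat (up x)).
  assert (HK : (Z.to_nat (up y) <= K)%nat) by (apply up_le; lra).
  unfold prime_pi_k, s. rewrite !(prime_class_sumE _ x m n K), (prime_class_sumE _ y m n K)
    by (try exact HK; apply Nat.le_refl).
  unfold Rdiv at 1 2. rewrite (Rmult_comm (lsum _ _) (/ _)), <- lsum_scal.
  split.
  - replace 0 with (lsum (seq 0 K) (fun _ => 0)) by (apply lsum_0; reflexivity).
    apply lsum_le. intros p. apply Rmult_le_pos; [apply Rlt_le, Rinv_0_lt_compat; lra|].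
    unfold class_term. destruct prime_in_class; [|lra]. destruct Rle_dec; [|lra].
    apply Rlt_le, Rpower_pos.
  - unfold Rminus. rewrite <- (Rmult_1_l (lsum _ (class_term _ y _ _))).
    rewrite Ropp_mult_distr_l, <- !lsum_scal, <- !lsum_plus.
    apply lsum_le. intros p. unfold class_term.
    destruct (prime_in_class m n p) eqn:E; [|lra].
    apply prime_in_class_ge2 in E.
    assert (Ep : Rpower (INR p) (c - 1) = Rpower (INR p) c * / INR p).
    { unfold Rminus. rewrite Rpower_plus. f_equal.
      replace (-1) with (Ropp 1) by lra. rewrite Rpower_Ropp, Rpower_1; lra. }
    fold (Rminus c 1). rewrite Ep.
    assert (Hi : 0 < / INR p) by (apply Rinv_0_lt_compat; lra).
    assert (Hix : 0 < / Rpower x c) by (apply Rinv_0_lt_compat; lra).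
    assert (Hr : 0 <= Rpower y c / Rpower x c) by (apply Rle_mult_inv_pos; lra).
    destruct (Rle_dec (INR p) x) as [px|px]; destruct (Rle_dec (INR p) y) as [py|py];
      try lra.
    + assert (Rpower (INR p) c <= Rpower y c) by (apply Rle_Rpower_l; lra).
      assert (/ Rpower x c * Rpower (INR p) c <= Rpower y c / Rpower x c)
        by (unfold Rdiv; rewrite (Rmult_comm (Rpower y c)); apply Rmult_le_compat_l; lra).
      nra.
    + assert (Rpower (INR p) c <= Rpower x c) by (apply Rle_Rpower_l; lra).
      assert (/ Rpower x c * Rpower (INR p) c <= 1).
      { apply (Rmult_le_reg_l (Rpower x c)); [lra|]. rewrite <- Rmult_assoc, Rinv_r; lra. }
      nra.
Qed.

(** Serves twice: with [c = k + 1] at [x], and with [c = 1] at [x^(k+1)], where the sum of [p^0] is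
    [prime_pi]. *)
Lemma power_sum_negligible c : 0 < c ->
  is_lim (fun x => prime_pi_k (c - 1) x m n / Rpower x c) p_infty 0.
Proof.
  intros Hc. pose proof phi_ge1 as Hp. apply is_lim_spec. intros eps.
  pose proof (cond_pos eps) as He.
  (* With this [a] the sum of [1/p] over the primes between [x^a] and [x] tends to
     [(eps / 4) / ph <= eps / 4]. Allowing a further [eps / 4] for that limit and [eps / 4] for the
     primes up to [x^a] gives at most [3/4 * eps]. *)
  set (a := exp (- (eps / 4))).
  assert (Ha : 0 < a < 1).
  { split; [apply exp_pos|]. rewrite <- exp_0. apply exp_increasing. lra. }
  assert (H1 := recip_sum_ratio a ltac:(lra)).
  assert (H2 := recip_sum_Rpower_neg (c * (1 - a)) ltac:(nra)).
  apply is_lim_spec in H1. apply is_lim_spec in H2.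
  assert (He4 : 0 < eps / 4) by lra.
  specialize (H1 (mkposreal _ He4)). specialize (H2 (mkposreal _ He4)).
  generalize (filter_and _ _ (filter_and _ _ H1 H2) (near_p_infty_gt 1)).
  apply filter_imp. intros x [[h1 h2] h3]. simpl in h1, h2.
  unfold a in h1 at 2; rewrite ln_exp in h1; fold a in h1.
  assert (Hy : 0 < Rpower x a <= x).
  { split; [apply Rpower_pos|]. rewrite <- (Rpower_1 x) at 2 by lra.
    apply Rle_Rpower; lra. }
  destruct (power_sum_bounds c x (Rpower x a) Hc Hy) as [b1 b2].
  rewrite Rpower_mult in b2. unfold Rdiv in b2 at 2. rewrite <- Rpower_Ropp, <- Rpower_plus in b2.
  replace (a * c + - c) with (- (c * (1 - a))) in b2 by ring.
  assert (Hq : - - (eps / 4) / ph <= eps / 4).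
  { apply (Rmult_le_reg_r ph); [lra|]. unfold Rdiv at 1. rewrite Rmult_assoc, Rinv_l by lra. nra. }
  rewrite Rminus_0_r, Rabs_pos_eq by exact b1.
  apply Rabs_def2 in h1. apply Rabs_def2 in h2. lra.
Qed.

End Limit.

Theorem theorem2 (k : R) (m n : nat) :
  -1 < k -> (0 < m)%nat -> (0 < n)%nat -> Nat.gcd m n = 1%nat ->
  let f := fun t : R =>
    (prime_pi_k k t m n - prime_pi (Rpower t (k + 1)) m n) / Rpower t (k + 2) in
  let L := - ln (k + 1) / ((k + 1) * INR (phi m)) in
  is_lim (fun x => RInt f 1 x) p_infty L /\
  (0 < k -> L < 0) /\ (k < 0 -> 0 < L).
Proof.
  intros Hk Hm Hn Hg f L. pose proof (phi_ge1 m Hm) as Hp.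
  assert (Hkp : 0 < (k + 1) * INR (phi m)) by (apply Rmult_lt_0_compat; lra).
  assert (HI : 0 < / ((k + 1) * INR (phi m))) by now apply Rinv_0_lt_compat.
  split; [|split; intros Hs].
  (* The exponents are written [k + 1 - 1] and [1 - 1], and a power 1 is inserted, so that both
     boundary terms are literal instances of [power_sum_negligible]. *)
  - apply (is_lim_ext_loc (fun x => / (k + 1) *
      ((prime_class_sum (fun p => / INR p) x m n
          - prime_class_sum (fun p => / INR p) (Rpower x (k + 1)) m n)
       - prime_pi_k (k + 1 - 1) x m n / Rpower x (k + 1)
       + prime_pi_k (1 - 1) (Rpower x (k + 1)) m n / Rpower (Rpower x (k + 1)) 1))).
    + exists 1. intros x Hx. unfold f. rewrite RInt_prime_difference by lra.
      replace (k + 1 - 1) with k by ring. rewrite Rpower_1 by apply Rpower_pos.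
      replace (prime_pi_k (1 - 1) (Rpower x (k + 1)) m n)
        with (prime_pi (Rpower x (k + 1)) m n).
      { unfold Rdiv. ring. }
      apply prime_class_sum_ext. intros p Hp2.
      replace (1 - 1) with 0 by ring. now rewrite Rpower_O by lra.
    + replace (Finite L) with
        (Rbar_mult (/ (k + 1)) (Finite (- ln (k + 1) / INR (phi m) - 0 + 0)))
        by (simpl; f_equal; unfold L; field; lra).
      apply is_lim_scal_l. apply is_lim_plus'; [apply is_lim_minus'|].
      * apply recip_sum_ratio; trivial; lra.
      * apply power_sum_negligible; trivial; lra.
      * apply (is_lim_comp (fun y => prime_pi_k (1 - 1) y m n / Rpower y 1)
          (fun x => Rpower x (k + 1)) p_infty 0 p_infty).
        -- apply power_sum_negligible; trivial; lra.
        -- apply is_lim_Rpower_p; lra.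
        -- apply filter_forall; discriminate.
  - assert (0 < ln (k + 1)) by (rewrite <- ln_1; apply ln_increasing; lra).
    unfold L, Rdiv. nra.
  - assert (ln (k + 1) < 0) by (rewrite <- ln_1; apply ln_increasing; lra).
    unfold L, Rdiv. nra.
Qed.
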